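(* Let $d\ge2$ and let $x_1,\dots,x_{d-1}\in\{-1,1\}$ be fixed and known to the statistician. Let $u$ be uniformly random on $\mathcal S^{d-1}$. Conditionally on $u$, let $z_1,\dots,z_{d-1}$ be independent with $z_i\sim\mathcal N(x_iu,I_d-uu^\top)$. Then every estimator $\hat u=\hat u(\{(x_i,z_i)\}_{i=1}^{d-1})\in\mathcal S^{d-1}$ (any measurable function of the data) satisfies $\Pr[\hat u=u]\le1/2$. *)

(* Defs.v *)
From HB Require Import structures.
From mathcomp Require Import all_boot all_order all_algebra.
From mathcomp Require Import all_classical all_reals all_analysis.
Set Implicit Arguments. Unset Strict Implicit. Unset Printing Implicit Defensive.
Import Order.TTheory GRing.Theory Num.Theory.
Local Open Scope classical_set_scope.
Local Open Scope ring_scope.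

Definition mx_cyl {R : realType} (k n : nat) : set (set 'M[R]_(k, n)) :=
  [set C | exists (i : 'I_k) (j : 'I_n) (A : set R),
     measurable A /\ C = [set M : 'M[R]_(k, n) | A (M i j)]].

Definition mx_borel {R : realType} (k n : nat) : set (set 'M[R]_(k, n)) :=
  <<s (@mx_cyl R k n) >>.

Definition mx_measurable {R : realType} (k n k' n' : nat)
  (f : 'M[R]_(k, n) -> 'M[R]_(k', n')) : Prop :=
  forall B, mx_borel B -> mx_borel (f @^-1` B).

Definition on_sphere {R : realType} (n : nat) (v : 'rV[R]_n) : Prop :=
  v *m v^T = 1%:M.

Definition orthogonal_mx {R : realType} (n : nat) (Q : 'M[R]_n) : Prop :=
  Q *m Q^T = 1%:M.

(* A random vector u on a probability space is uniformly distributed on the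
   sphere S^{n-1}: it lies on the sphere and its law is invariant under every
   orthogonal transformation (the normalized surface measure is the unique
   rotation-invariant Borel probability measure on the sphere). *)
Definition uniform_on_sphere {R : realType} {d0 : measure_display}
  {Omega : measurableType d0} (P : probability Omega R) (n : nat)
  (u : Omega -> 'rV[R]_n) : Prop :=
  (forall o, on_sphere (u o)) /\
  forall Q : 'M[R]_n, orthogonal_mx Q ->
  forall B, mx_borel B -> P (u @^-1` B) = P ((fun o => u o *m Q) @^-1` B).

Definition indep_std_gauss {R : realType} {d0 : measure_display}
  {Omega : measurableType d0} (P : probability Omega R) (n k : nat)
  (u : Omega -> 'rV[R]_n) (w : 'I_k -> Omega -> 'rV[R]_n) : Prop :=
  forall (B : set 'rV[R]_n) (A : 'I_k -> 'I_n -> set R),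
    mx_borel B -> (forall i j, measurable (A i j)) ->
    P (u @^-1` B `&` \bigcap_(i in [set: 'I_k]) \bigcap_(j in [set: 'I_n])
                         [set o | A i j (w i o 0 j)])
    = (P (u @^-1` B) *
       \big[*%E/1%E]_(i < k) \big[*%E/1%E]_(j < n) normal_prob 0 1 (A i j))%E.

(* Observation z_i = x_i u + (I - u^T u) w_i  (row-vector convention):
   conditionally on u, z_i ~ N(x_i u, (I - u u^T)(I - u u^T)^T) = N(x_i u, I - u u^T),
   independently over i, when the w_i are i.i.d. N(0, I) independent of u. *)
Definition obs {R : realType} (n k : nat) (x : 'I_k -> R)
  (u : 'rV[R]_n) (w : 'I_k -> 'rV[R]_n) : 'M[R]_(k, n) :=
  \matrix_(i < k, j < n) (x i *: u + w i *m (1%:M - u^T *m u)) 0 j.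

(* Main.v *)
Require Import Defs.
From HB Require Import structures.
From mathcomp Require Import all_boot all_order all_algebra.
From mathcomp Require Import all_classical all_reals all_analysis.
From mathcomp Require Import measurable_realfun.
From mathcomp Require Import ring lra.
Import Order.TTheory GRing.Theory Num.Theory.
Local Open Scope classical_set_scope.
Local Open Scope ring_scope.
Set Implicit Arguments. Unset Strict Implicit. Unset Printing Implicit Defensive.

(* Stack u and the w_i into a square matrix M; it is almost surely invertible and
   its law is invariant under right multiplication by a fixed orthogonal matrix.
   The observation Z is a function of M with Z (M Q) = Z M Q, and its rows are
   almost surely independent. The reflection H through the row span of Z fixes
   every row of Z, so M and M H yield the same observation, whereas u H <> u.
   Since H depends on M, the equality in law of M and M H is obtained by
   averaging over a Haar matrix, namely the Gram-Schmidt factor of an independent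
   copy of M. The estimator thus sees the two distinct candidates u and u H with
   the same probability, and cannot be right with probability above 1/2. *)

(** * Planar rotations of the normal law *)

(** There are [d - 1] observations in dimension [d], so their span misses exactly one direction:
    just enough room for a reflection that moves [u]. No conditional law given the observation is
    formed; comparing the probabilities of two events suffices. Normality is given only through
    products of coordinate sets, where orthogonal invariance is invisible. It is recovered from
    generators that mix two coordinates at a time, for which a substitution in the planar density is
    enough. Invertibility of [M] serves twice: it makes the Gram-Schmidt factor orthogonal and keeps
    [u] out of the span of the observation. A joint density cannot give it, since [u] lives on a
    sphere; instead, each leading minor beyond the first is affine in a Gaussian corner entry. *)

Lemma measurable_affine (R : realType) (c t : R) :
  measurable_fun [set: R] (fun x : R => c * x + t).
Proof.
apply: measurable_funD => //; apply: measurable_funM => //.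
Qed.

Lemma lebesgue_measure_affine (R : realType) (c t : R) (A : set R) :
  c != 0 -> measurable A ->
  (`|c|%:E * lebesgue_measure ((fun x : R => c * x + t)%R @^-1` A)
    = lebesgue_measure A)%E.
Proof.
move=> c0 mA.
have mf : measurable_fun [set: measurableTypeR R]
    (fun x : R => (c * x + t : measurableTypeR R)) := @measurable_affine R c t.
pose c' : {nonneg R} := NngNum (normr_ge0 c).
pose f : {mfun measurableTypeR R >-> measurableTypeR R} :=
  HB.pack (fun x : R => c * x + t) (isMeasurableFun.Build _ _ _ _ _ mf).
rewrite [RHS](@lebesgue_measure_unique R (mscale c' (pushforward lebesgue_measure f)))//.
move=> _ [[a b] _ <-]/=; rewrite /mscale/= /pushforward.
(* The sign of the slope decides which end of the preimage of a half-open interval is closed. *)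
have [c_lt|c_gt|/eqP] := ltrgtP c 0; last by rewrite (negbTE c0).
- rewrite (_ : _ @^-1` _ = `[(b - t) / c, (a - t) / c[%classic); last first.
    apply/seteqP; split=> x /=; rewrite !in_itv/= => /andP[h1 h2]; apply/andP; split.
    + by rewrite ler_ndivrMr// mulrC; lra.
    + by rewrite ltr_ndivlMr// mulrC; lra.
    + by move: h2; rewrite ltr_ndivlMr// mulrC; lra.
    + by move: h1; rewrite ler_ndivrMr// mulrC; lra.
  rewrite !lebesgue_measure_itv/= !lte_fin ltr_nM2r ?invr_lt0// ltrD2r.
  case: ifPn => _; last by rewrite mule0.
  by rewrite -!EFinD -EFinM; congr EFin; rewrite ltr0_norm//; field.
- rewrite (_ : _ @^-1` _ = `](a - t) / c, (b - t) / c]%classic); last first.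
    apply/seteqP; split=> x /=; rewrite !in_itv/= => /andP[h1 h2]; apply/andP; split.
    + by rewrite ltr_pdivrMr// mulrC; lra.
    + by rewrite ler_pdivlMr// mulrC; lra.
    + by move: h1; rewrite ltr_pdivrMr// mulrC; lra.
    + by move: h2; rewrite ler_pdivlMr// mulrC; lra.
  rewrite !lebesgue_measure_itv/= !lte_fin ltr_pM2r ?invr_gt0// ltrD2r.
  case: ifPn => _; last by rewrite mule0.
  by rewrite -!EFinD -EFinM; congr EFin; rewrite gtr0_norm//; field.
Qed.

Lemma ge0_integral_affine (R : realType) (c t : R) (f : R -> \bar R) :
  c != 0 -> measurable_fun [set: R] f -> (forall x, 0 <= f x)%E ->
  (\int[lebesgue_measure]_x f x =
   `|c|%:E * \int[lebesgue_measure]_x f (c * x + t)%R)%E.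
Proof.
move=> c0 mf f0.
have mg : measurable_fun [set: measurableTypeR R]
    (fun x : R => (c * x + t : measurableTypeR R)) := @measurable_affine R c t.
pose c' : {nonneg R} := NngNum (normr_ge0 c).
pose g : {mfun measurableTypeR R >-> measurableTypeR R} :=
  HB.pack (fun x : R => c * x + t) (isMeasurableFun.Build _ _ _ _ _ mg).
rewrite (eq_measure_integral (mscale c' (pushforward lebesgue_measure g))); last first.
  by move=> A mA _; exact/esym/lebesgue_measure_affine.
rewrite ge0_integral_mscale//=; congr (_ * _)%E.
by rewrite ge0_integral_pushforward// preimage_setT.
Qed.

(** [normal_pdf] is, up to a null set, the Radon-Nikodym derivative of the normal law, since both
    have the same integral over every measurable set. *)
Lemma integral_normal_prob (R : realType) (m s : R) (f : R -> \bar R) :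
  (normal_prob m s).-integrable setT f ->
  (\int[normal_prob m s]_x f x =
   \int[lebesgue_measure]_x (f x * (normal_pdf m s x)%:E))%E.
Proof.
move=> intf; have mf := measurable_int _ intf.
rewrite -(Radon_Nikodym_change_of_variables (normal_prob_dominates m s))//=.
apply: ae_eq_integral => //.
- apply: emeasurable_funM => //; apply: (measurable_int lebesgue_measure).
  by apply: Radon_Nikodym_integrable; exact: normal_prob_dominates.
- apply: emeasurable_funM => //=; apply/measurableT_comp => //=.
  exact: measurable_normal_pdf.
- apply: ae_eqe_mul2l => /=.
  rewrite Radon_NikodymE//=; first exact: normal_prob_dominates.
  move=> dom; case: cid => /= h [h1 h2 h3].
  apply: integral_ae_eq => //=.
  + by apply/measurableT_comp =>//; exact: measurable_normal_pdf.
  + by move=> E E01 mE; rewrite -h3.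
Qed.

(** Tonelli splits the planar substitution into two affine ones, in [x] at fixed [y] and then in [y]
    at fixed [a]; their factors [|c^-1|] and [|c|] cancel. The division by [c] is why [c = 0] is
    excluded. *)
Lemma ge0_integral_rotate (R : realType) (c s : R) (F : R * R -> \bar R) :
  c != 0 -> c ^+ 2 + s ^+ 2 = 1 ->
  measurable_fun [set: R * R] F -> (forall p, 0 <= F p)%E ->
  (\int[lebesgue_measure]_x \int[lebesgue_measure]_y F (x, y) =
   \int[lebesgue_measure]_a \int[lebesgue_measure]_b
     F (c * a + s * b, s * a - c * b)%R)%E.
Proof.
move=> c0 cs1 mF F0.
rewrite (@fubini_tonelli _ _ _ _ R lebesgue_measure lebesgue_measure F)//=.
(* [G] is [F] after [x = (a - s * y) / c]; inserting [y = s * a - c * b] then gives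
   [x = c * a + s * b], because [1 - s ^+ 2 = c ^+ 2]. *)
pose G (p : R * R) := F (c^-1 * p.1 + - (s / c * p.2), p.2).
have mG : measurable_fun [set: R * R] G.
  apply: measurableT_comp => //; apply: measurable_fun_pair => //=.
  apply: measurable_funB; first by apply: measurable_funM.
  by apply: measurable_funM.
have G0 p : (0 <= G p)%E by exact: F0.
have c'0 : (0 <= `|c|%:E)%E by [].
have c''0 : (0 <= `|c^-1|%:E)%E by [].
under eq_integral => y _.
  rewrite (@ge0_integral_affine R c^-1 (- (s / c * y)) (fun x => F (x, y)))//; last 2 first.
  - by rewrite invr_neq0.
  - by apply: measurableT_comp => //; exact: measurable_pair2.
  rewrite -/(G (_, y)).
  over.
rewrite ge0_integralZl//=; last 2 first.
- exact: (@measurable_fun_fubini_tonelli_G _ _ _ _ R lebesgue_measure G mG G0).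
- by move=> y _; apply: integral_ge0 => x _; exact: F0.
rewrite -(@fubini_tonelli _ _ _ _ R lebesgue_measure lebesgue_measure G)//.
under eq_integral => a _.
  rewrite (@ge0_integral_affine R (- c) (s * a) (fun y => G (a, y)))//; last 2 first.
  - by rewrite oppr_eq0.
  - by apply: measurableT_comp => //; exact: measurable_pair1.
  rewrite normrN.
  over.
rewrite ge0_integralZl//=; last 2 first.
- pose G' (p : R * R) := G (p.1, - c * p.2 + s * p.1).
  have mG' : measurable_fun setT G'.
    apply: measurableT_comp => //; apply: measurable_fun_pair => //=.
    by apply: measurable_funD; apply: measurable_funM.
  exact: (@measurable_fun_fubini_tonelli_F _ _ _ _ R lebesgue_measure G' mG' (fun p => F0 _)).
- by move=> y _; apply: integral_ge0 => x _; exact: F0.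
rewrite muleA -EFinM -normrM mulVf// normr1 mul1e.
apply: eq_integral => a _; apply: eq_integral => b _; rewrite /G/=.
congr (F (_, _)); last by ring.
transitivity ((1 - s ^+ 2) / c * a + s * b); first by field.
by rewrite -cs1 addrK; field.
Qed.

Lemma measurable_rotate_rect (R : realType) (c s : R) (A B : set R) :
  measurable A -> measurable B ->
  measurable [set p : R * R | A (c * p.1 + s * p.2) /\ B (s * p.1 - c * p.2)].
Proof.
move=> mA mB; apply: measurableI.
- rewrite -[X in measurable X]setTI; apply: (_ : measurable_fun _ _) => //.
  by apply: measurable_funD; apply: measurable_funM.
- rewrite -[X in measurable X]setTI; apply: (_ : measurable_fun _ _) => //.
  by apply: measurable_funB; apply: measurable_funM.
Qed.

Lemma normal_pdf01M (R : realType) (x y : R) :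
  normal_pdf 0 1 x * normal_pdf 0 1 y =
  normal_peak 1 ^+ 2 * expR (- (x ^+ 2 + y ^+ 2) / 2) :> R.
Proof.
rewrite !normal_pdfE ?oner_neq0//= /normal_fun mulrACA -expRD expr2.
by congr (_ * expR _); field.
Qed.

Lemma normal_prodE (R : realType) (D : set (R * R)) : measurable D ->
  ((normal_prob 0 1 \x normal_prob 0 1) D =
  \int[lebesgue_measure]_x \int[lebesgue_measure]_y
     (\1_D (x, y) * (normal_pdf 0 1 x * normal_pdf 0 1 y))%:E)%E.
Proof.
move=> mD; rewrite /product_measure1 integral_normal_prob/=.
  apply: eq_integral => x _; rewrite /normal_prob integral_mkcond/=.
  rewrite -ge0_integralZr//=; last 3 first.
  - apply/measurable_restrict => //; first exact: measurable_xsection.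
    by apply/measurable_funTS/measurableT_comp => //; exact: measurable_normal_pdf.
  - move=> y _; rewrite patchE; case: ifP => // _.
    by rewrite lee_fin normal_pdf_ge0.
  - by rewrite lee_fin normal_pdf_ge0.
  apply: eq_integral => y _; rewrite patchE indicE mem_xsection.
  by case: ifP => _; rewrite ?mul0e ?mul0r// mul1r mulrC EFinM.
apply: (@le_integrable _ _ _ _ _ _ _ (cst 1%E)) => //.
- exact: measurable_fun_xsection.
- move=> x _; rewrite /= gee0_abs// normr1 probability_le1//.
  exact: measurable_xsection.
- exact: finite_measure_integrable_cst.
Qed.

(** The density of the pair depends only on [x ^+ 2 + y ^+ 2], which the reflection preserves; being
    its own inverse, the reflection turns the event back into the product of [A] and [B]. *)
Lemma normal_prob_rotate (R : realType) (c s : R) (A B : set R) :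
  c != 0 -> c ^+ 2 + s ^+ 2 = 1 -> measurable A -> measurable B ->
  ((normal_prob 0 1 \x normal_prob 0 1)
    [set p : R * R | A (c * p.1 + s * p.2)%R /\ B (s * p.1 - c * p.2)%R]
   = normal_prob 0 1 A * normal_prob 0 1 B)%E.
Proof.
move=> c0 cs mA mB; have mD := measurable_rotate_rect c s mA mB.
rewrite normal_prodE//.
pose F (p : R * R) := (\1_[set p : R * R | A (c * p.1 + s * p.2)%R /\ B (s * p.1 - c * p.2)%R] p *
   (normal_pdf 0 1 p.1 * normal_pdf 0 1 p.2))%:E.
rewrite (@ge0_integral_rotate R c s F)//; last 2 first.
- apply/measurable_EFinP; apply: measurable_funM => //.
  by apply: measurable_funM; apply: measurableT_comp => //; exact: measurable_normal_pdf.
- by move=> p; rewrite lee_fin mulr_ge0// mulr_ge0// normal_pdf_ge0.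
rewrite -[RHS](@product_measure1E _ _ _ _ R (normal_prob 0 1) (normal_prob 0 1) A B mA mB).
rewrite [RHS](normal_prodE (measurableX mA mB)).
apply: eq_integral => a _; apply: eq_integral => b _; rewrite /F/= !normal_pdf01M.
congr (_ * (_ * expR (- _ / _)))%:E; last first.
  transitivity ((c ^+ 2 + s ^+ 2) * (a ^+ 2 + b ^+ 2)); first by ring.
  by rewrite cs mul1r.
have ea : (c * (c * a + s * b) + s * (s * a - c * b)) = a.
  by transitivity ((c ^+ 2 + s ^+ 2) * a); [ring|rewrite cs mul1r].
have eb : (s * (c * a + s * b) - c * (s * a - c * b)) = b.
  by transitivity ((c ^+ 2 + s ^+ 2) * b); [ring|rewrite cs mul1r].
by rewrite !indicE; congr (nat_of_bool _)%:R; apply/idP/idP;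
  rewrite !inE /= ?ea ?eb.
Qed.

(** * Random matrices *)

Lemma measurable_forall (d : measure_display) (T : measurableType d)
    (I : finType) (F : I -> set T) :
  (forall i, measurable (F i)) -> measurable [set o | forall i, F i o].
Proof.
move=> mF; rewrite (_ : mkset _ = \bigcap_(i in [set: I]) F i).
  by apply: fin_bigcap_measurable => // i _; exact: mF.
by apply/seteqP; split=> o /= h i; [move=> _|]; apply: h.
Qed.

Definition measurable_mx (R : realType) (d : measure_display)
    (T : measurableType d) (m n : nat) (X : T -> 'M[R]_(m, n)) :=
  forall i j, measurable_fun setT (fun o => X o i j).

(** A copy of the matrix type that carries [mx_borel] as its measurable structure, so that results
    on measurable maps and pushforwards apply to matrices. *)
Definition mxT (R : realType) (m n : nat) : Type := 'M[R]_(m, n).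

Section mxT_measurable.
Variables (R : realType) (m n : nat).

HB.instance Definition _ := Choice.on (mxT R m n).
HB.instance Definition _ := isPointed.Build (mxT R m n) (0 : 'M[R]_(m, n)).

Lemma mx_borelC (B : set (mxT R m n)) : mx_borel B -> mx_borel (~` B).
Proof. by move=> mB; rewrite -setTD; exact: sigma_algebraCD. Qed.

HB.instance Definition _ := @isMeasurable.Build (sigma_display (@mx_cyl R m n))
  (mxT R m n) (@mx_borel R m n) (@sigma_algebra0 _ setT (@mx_cyl R m n)) mx_borelC
  (@sigma_algebra_bigcup _ setT (@mx_cyl R m n)).

End mxT_measurable.

Lemma measurable_mx_id (R : realType) (m n : nat) :
  @measurable_mx R _ (mxT R m n) m n id.
Proof.
move=> i j _ A mA; rewrite setTI; apply: sub_sigma_algebra.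
by exists i, j, A.
Qed.

Lemma measurable_mxP (R : realType) (d : measure_display)
    (T : measurableType d) (m n : nat) (X : T -> 'M[R]_(m, n)) :
  measurable_mx X <-> measurable_fun setT (X : T -> mxT R m n).
Proof.
split=> [mX|mX i j].
  apply: (@measurability _ _ _ _ setT (X : T -> mxT R m n) (@mx_cyl R m n)) => //.
  move=> _ [_ [i [j [A [mA ->]]]] <-]; exact: mX.
exact: (measurableT_comp (@measurable_mx_id R m n i j) mX).
Qed.

Lemma measurable_mx_preimage (R : realType) (d : measure_display)
    (T : measurableType d) (m n : nat) (X : T -> 'M[R]_(m, n)) B :
  measurable_mx X -> mx_borel B -> measurable (X @^-1` B).
Proof.
by move=> /measurable_mxP mX mB; rewrite -[X in measurable X]setTI; exact: mX.
Qed.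

Definition mx_rect (R : realType) (m n : nat) (A : 'I_m -> 'I_n -> set R) :=
  [set M : 'M[R]_(m, n) | forall p : 'I_m * 'I_n, A p.1 p.2 (M p.1 p.2)].

Lemma mx_borel_rect (R : realType) (m n : nat) (A : 'I_m -> 'I_n -> set R) :
  (forall i j, measurable (A i j)) -> mx_borel (mx_rect A).
Proof.
move=> mA.
apply: (@measurable_forall _ (mxT R m n) _ (fun p : 'I_m * 'I_n =>
  [set M : 'M[R]_(m, n) | A p.1 p.2 (M p.1 p.2)])) => p.
by apply: sub_sigma_algebra; exists p.1, p.2, (A p.1 p.2).
Qed.

(** Rectangles are stable under intersection, contain the whole space and generate [mx_borel].
    Finiteness is asked of [mu1] only, so that [mu2] may be a product measure. *)
Lemma eq_law_mx (R : realType) (d1 d2 : measure_display)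
    (T1 : measurableType d1) (T2 : measurableType d2) (m n : nat)
    (mu1 : {finite_measure set T1 -> \bar R})
    (mu2 : {measure set T2 -> \bar R})
    (X : T1 -> 'M[R]_(m, n)) (Y : T2 -> 'M[R]_(m, n)) :
  measurable_mx X -> measurable_mx Y ->
  (forall A, (forall i j, measurable (A i j)) ->
     mu1 (X @^-1` mx_rect A) = mu2 (Y @^-1` mx_rect A)) ->
  forall B, mx_borel B -> mu1 (X @^-1` B) = mu2 (Y @^-1` B).
Proof.
move=> /measurable_mxP mX /measurable_mxP mY eqXY B mB.
pose f : {mfun T1 >-> mxT R m n} :=
  HB.pack (X : T1 -> mxT R m n) (isMeasurableFun.Build _ _ _ _ _ mX).
pose g : {mfun T2 >-> mxT R m n} :=
  HB.pack (Y : T2 -> mxT R m n) (isMeasurableFun.Build _ _ _ _ _ mY).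
pose G : set (set (mxT R m n)) := [set C | exists A,
   (forall i j, measurable (A i j)) /\ C = mx_rect A].
have rectT : mx_rect (fun _ _ => setT) = [set: 'M[R]_(m, n)] by apply/seteqP; split.
suff : forall E, <<s G >> E -> pushforward mu1 f E = pushforward mu2 g E.
  apply; move: B mB; apply: smallest_sub; first exact: smallest_sigma_algebra.
  move=> _ [i [j [A [mA ->]]]]; apply: sub_sigma_algebra.
  exists (fun i' j' => if (i' == i) && (j' == j) then A else setT); split.
    by move=> i' j'; case: ifP.
  apply/seteqP; split => M /=.
    by move=> AM [i' j'] /=; case: ifP => // /andP[/eqP -> /eqP ->].
  by move=> /(_ (i, j)) /=; rewrite !eqxx.
apply: (@g_sigma_algebra_measure_unique _ R (mxT R m n) G _ (fun=> setT)).
- by move=> _ [A [mA ->]]; exact: mx_borel_rect.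
- by move=> _; exists (fun _ _ => setT); split => //; rewrite rectT.
- by rewrite bigcup_const.
- move=> _ _ [A [mA ->]] [A' [mA' ->]].
  exists (fun i j => A i j `&` A' i j); split; first by move=> i j; exact: measurableI.
  apply/seteqP; split => M /=; first by move=> [h1 h2] p; split; [exact: h1|exact: h2].
  by move=> h; split=> p; have [] := h p.
- by move=> _ [A [mA ->]]; exact: eqXY.
- move=> _; rewrite /= /pushforward preimage_setT.
  by rewrite -ge0_fin_numE// fin_num_measure.
Qed.

(** Measurability is taken from the power function, which inverts nonnegative numbers; hence the
    detour through [x ^+ 2]. At 0 both expressions vanish. *)
Lemma measurable_inv (R : realType) : measurable_fun [set: R] (@GRing.inv R).
Proof.
have -> : (@GRing.inv R) = (fun x => x * (x ^+ 2) `^ (-1)).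
  apply/funext => x; rewrite powR_inv1 ?sqr_ge0//.
  have [->|x0] := eqVneq x 0; first by rewrite invr0 mul0r.
  by rewrite expr2 invfM mulrA divff// mul1r.
apply: measurable_funM => //.
by apply: (measurableT_comp (measurable_powR (-1))).
Qed.

Lemma measurable_sqrt (R : realType) : measurable_fun [set: R] (@Num.sqrt R).
Proof.
have -> : (@Num.sqrt R) = (fun x => if 0 <= x then x `^ (2^-1) else 0).
  apply/funext => x; case: ifPn => x0; first by rewrite powR12_sqrt.
  by rewrite ler0_sqrtr// ltW// ltNge.
by apply: measurable_fun_ifT => //; exact: measurable_fun_ler.
Qed.

Section measurable_mx_theory.
Context (R : realType) (d : measure_display) (T : measurableType d).

Lemma measurable_mx_cst m n (A : 'M[R]_(m, n)) : measurable_mx (fun _ : T => A).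
Proof. by []. Qed.

Lemma measurable_mx_mul m n p (X : T -> 'M[R]_(m, n)) (Y : T -> 'M[R]_(n, p)) :
  measurable_mx X -> measurable_mx Y -> measurable_mx (fun o => X o *m Y o).
Proof.
move=> mX mY i j; under eq_fun do rewrite mxE.
by apply: measurable_sum => l; apply: measurable_funM.
Qed.

Lemma measurable_mx_add m n (X Y : T -> 'M[R]_(m, n)) :
  measurable_mx X -> measurable_mx Y -> measurable_mx (fun o => X o + Y o).
Proof.
by move=> mX mY i j; under eq_fun do rewrite mxE; apply: measurable_funD.
Qed.

Lemma measurable_mx_opp m n (X : T -> 'M[R]_(m, n)) :
  measurable_mx X -> measurable_mx (fun o => - X o).
Proof.
by move=> mX i j; under eq_fun do rewrite mxE; apply: measurable_funN.
Qed.

Lemma measurable_mx_sub m n (X Y : T -> 'M[R]_(m, n)) :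
  measurable_mx X -> measurable_mx Y -> measurable_mx (fun o => X o - Y o).
Proof.
by move=> mX mY; apply: measurable_mx_add => //; exact: measurable_mx_opp.
Qed.

Lemma measurable_mx_tr m n (X : T -> 'M[R]_(m, n)) :
  measurable_mx X -> measurable_mx (fun o => (X o)^T).
Proof. by move=> mX i j; under eq_fun do rewrite mxE; exact: mX. Qed.

Lemma measurable_mx_scale m n (f : T -> R) (X : T -> 'M[R]_(m, n)) :
  measurable_fun setT f -> measurable_mx X -> measurable_mx (fun o => f o *: X o).
Proof.
by move=> mf mX i j; under eq_fun do rewrite mxE; apply: measurable_funM.
Qed.

Lemma measurable_mx_col_mx m1 m2 n (X : T -> 'M[R]_(m1, n)) (Y : T -> 'M[R]_(m2, n)) :
  measurable_mx X -> measurable_mx Y -> measurable_mx (fun o => col_mx (X o) (Y o)).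
Proof.
move=> mX mY i j; under eq_fun do rewrite mxE.
by case: (fintype.split i) => l; [exact: mX|exact: mY].
Qed.

Lemma measurable_mx_row m n (X : T -> 'M[R]_(m, n)) i :
  measurable_mx X -> measurable_mx (fun o => row i (X o)).
Proof. by move=> mX l j; under eq_fun do rewrite mxE; exact: mX. Qed.

Lemma measurable_mx_if m n (b : T -> bool) (X Y : T -> 'M[R]_(m, n)) :
  measurable_fun setT b -> measurable_mx X -> measurable_mx Y ->
  measurable_mx (fun o => if b o then X o else Y o).
Proof.
move=> mb mX mY i j.
rewrite (_ : (fun o => _) = (fun o => if b o then X o i j else Y o i j)).
  by apply: measurable_fun_ifT.
by apply/funext => o; case: (b o).
Qed.

Lemma measurable_det n (X : T -> 'M[R]_n) :
  measurable_mx X -> measurable_fun setT (fun o => \det (X o)).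
Proof.
move=> mX; apply: measurable_sum => s; apply: measurable_funM => //.
by apply: measurable_prod => i _; exact: mX.
Qed.

Lemma measurable_mx_inv n (X : T -> 'M[R]_n) :
  measurable_mx X -> measurable_mx (fun o => invmx (X o)).
Proof.
move=> mX; have mdet := measurable_det mX.
rewrite /invmx; under eq_fun do rewrite unitmxE unitfE.
apply: measurable_mx_if => //.
  by apply: measurableT_comp => //; exact: measurable_fun_eqr.
apply: measurable_mx_scale; first exact: (measurableT_comp (@measurable_inv R)).
move=> i j; under eq_fun do rewrite mxE.
apply: measurable_funM => //; apply: measurable_det => a b.
under eq_fun do rewrite !mxE; exact: mX.
Qed.

Lemma measurable_mx_eq m n (X Y : T -> 'M[R]_(m, n)) :
  measurable_mx X -> measurable_mx Y -> measurable [set o | X o = Y o].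
Proof.
move=> mX mY.
have -> : [set o | X o = Y o] =
    [set o | forall p : 'I_m * 'I_n, X o p.1 p.2 == Y o p.1 p.2].
  apply/seteqP; split => o /= => [-> //|h].
  by apply/matrixP => i j; apply/eqP; exact: (h (i, j)).
apply: (measurable_forall (F := fun p : 'I_m * 'I_n =>
   [set o | X o p.1 p.2 == Y o p.1 p.2])) => p.
rewrite -[X in measurable X]setTI.
exact: (measurable_fun_eqr (mX _ _) (mY _ _) measurableT (Y := [set true])).
Qed.

End measurable_mx_theory.

(** * Generation of the orthogonal group by plane reflections *)

(** The block with rows [(c, s)] and [(s, -c)] in the plane of the coordinates [a] and [b]. Unlike a
    rotation block, it is symmetric and, on the unit circle, its own inverse. *)
Definition plane_refl (R : realType) (n : nat) (a b : 'I_n) (c s : R) : 'M[R]_n :=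
  \matrix_(i, j) if j == a then c *+ (i == a) + s *+ (i == b)
                 else if j == b then s *+ (i == a) - c *+ (i == b)
                 else (i == j)%:R.

Lemma mulmx_plane_refl (R : realType) (m n : nat) (a b : 'I_n) (c s : R)
    (M : 'M[R]_(m, n)) i j : a != b ->
  (M *m plane_refl a b c s) i j =
    if j == a then c * M i a + s * M i b
    else if j == b then s * M i a - c * M i b else M i j.
Proof.
move=> ab; rewrite mxE; under eq_bigr do rewrite mxE.
have ba : b == a = false by rewrite eq_sym (negbTE ab).
have sum2 x y : \sum_i0 M i i0 * (x *+ (i0 == a) + y *+ (i0 == b)) = x * M i a + y * M i b.
  rewrite (bigD1 a)//= (bigD1 b)/=; last by rewrite eq_sym.
  rewrite big1 ?addr0; last first.
    by move=> l /andP[/negbTE-> /negbTE->]; rewrite addr0 mulr0.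
  by rewrite !eqxx (negbTE ab) ba addr0 add0r !mulr1n ![M i _ * _]mulrC.
case: ifP => [_|ja]; first exact: sum2.
case: ifP => [_|jb].
  by under eq_bigr do rewrite -mulNrn; rewrite sum2 mulNr.
rewrite (bigD1 j)//= eqxx mulr1 big1 ?addr0// => l /negbTE->.
by rewrite mulr0.
Qed.

Lemma plane_reflK (R : realType) (n : nat) (a b : 'I_n) (c s : R) : a != b ->
  c ^+ 2 + s ^+ 2 = 1 -> plane_refl a b c s *m plane_refl a b c s = 1%:M.
Proof.
move=> ab cs; have ba : b == a = false by rewrite eq_sym (negbTE ab).
rewrite -[X in X *m _]mul1mx.
apply/matrixP => i j; rewrite !mulmx_plane_refl// !eqxx ba.
have [->|ja] := eqVneq j a.
  by transitivity ((c ^+ 2 + s ^+ 2) * 1%:M i a); [ring|rewrite cs mul1r].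
have [->|//] := eqVneq j b.
by transitivity ((c ^+ 2 + s ^+ 2) * 1%:M i b); [ring|rewrite cs mul1r].
Qed.

Lemma tr_plane_refl (R : realType) (n : nat) (a b : 'I_n) (c s : R) : a != b ->
  (plane_refl a b c s)^T = plane_refl a b c s.
Proof.
move=> ab; have ba : b == a = false by rewrite eq_sym (negbTE ab).
apply/matrixP => i j; rewrite !mxE.
have [ia|ia] := eqVneq i a; have [ib|ib] := eqVneq i b;
  try (by move: ab; rewrite -ia ib eqxx);
have [ja|ja] := eqVneq j a; have [jb|jb] := eqVneq j b;
  try (by move: ab; rewrite -ja jb eqxx);
rewrite ?mulr0n ?mulr1n ?addr0 ?add0r ?subr0 ?sub0r ?oppr0//.
- by rewrite ia eq_sym (negbTE ja).
- by rewrite ib eq_sym (negbTE jb).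
- by rewrite ja eq_sym (negbTE ia).
- by rewrite jb eq_sym (negbTE ib).
- by rewrite eq_sym.
Qed.

(* Each row is brought to the corresponding basis vector by reflections in
   coordinate planes, each of which kills one off-diagonal entry. *)
Lemma orthogonal_mx_ind (R : realType) (n : nat) (S : 'M[R]_n.+2 -> Prop) :
  S 1%:M ->
  (forall Q a b c s, a != b -> c ^+ 2 + s ^+ 2 = 1 -> c != 0 \/ c = 0 /\ s = 1 ->
     S Q -> S (Q *m plane_refl a b c s)) ->
  forall Q, orthogonal_mx Q -> S Q.
Proof.
move=> S1 SM Q oQ.
pose fixes k (Q : 'M[R]_n.+2) := forall i j : 'I_n.+2, (i < k)%N -> Q i j = (i == j)%:R.
have oM (Q' : 'M[R]_n.+2) a b c s : a != b -> c ^+ 2 + s ^+ 2 = 1 ->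
    orthogonal_mx Q' -> orthogonal_mx (Q' *m plane_refl a b c s).
  move=> ab cs oQ'; rewrite /orthogonal_mx trmx_mul tr_plane_refl// mulmxA.
  by rewrite -(mulmxA Q') plane_reflK// mulmx1.
(* Since a reflection undoes itself, [S] also passes backwards, and it is enough to reduce [Q] to
   the identity. *)
have SMr (Q' : 'M[R]_n.+2) a b c s : a != b -> c ^+ 2 + s ^+ 2 = 1 ->
    c != 0 \/ c = 0 /\ s = 1 -> S (Q' *m plane_refl a b c s) -> S Q'.
  move=> ab cs c0 SQ; rewrite -[Q']mulmx1 -(plane_reflK ab cs) mulmxA.
  exact: SM.
(* [k] counts the rows still to be treated; at [k = 0] the matrix is the identity. *)
suff H : forall k, (k <= n.+2)%N -> forall Q, orthogonal_mx Q -> fixes (n.+2 - k)%N Q -> S Q.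
  by apply: (H n.+2 (leqnn _) Q oQ) => i j; rewrite subnn.
elim=> [_ {}Q {}oQ fQ|k IHk kn {}Q {}oQ fQ].
  suff -> : Q = 1%:M by [].
  by apply/matrixP => i j; rewrite fQ ?subn0// mxE.
have ltl : (n.+2 - k.+1 < n.+2)%N by rewrite ltn_subrL.
pose l := Ordinal ltl.
have {}IHk Q' : orthogonal_mx Q' -> fixes (n.+2 - k.+1)%N Q' ->
    (forall j, Q' l j = (l == j)%:R) -> S Q'.
  move=> oQ' fQ' lQ'; apply: (IHk (ltnW kn) Q' oQ') => i j.
  rewrite -subSS subSn// ltnS leq_eqVlt => /orP[/eqP il|il]; last exact: fQ'.
  by have -> : i = l by exact: val_inj.
have normQ (Q' : 'M[R]_n.+2) : orthogonal_mx Q' -> \sum_j Q' l j ^+ 2 = 1.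
  move=> /matrixP /(_ l l); rewrite !mxE eqxx mulr1n => <-.
  by apply: eq_bigr => j _; rewrite mxE.
(* The rows above are basis vectors and row [l] is orthogonal to them. Its nonzero off-diagonal
   entries thus lie right of the diagonal, and clearing them leaves the rows above intact. *)
have ortQ (Q' : 'M[R]_n.+2) (j : 'I_n.+2) : orthogonal_mx Q' -> fixes (n.+2 - k.+1)%N Q' ->
    (j < l)%N -> Q' l j = 0.
  move=> /matrixP /(_ l j); rewrite !mxE => h f jl.
  have -> : Q' l j = \sum_i Q' l i * Q'^T i j.
    rewrite (bigD1 j)//= mxE (f j)// eqxx mulr1 big1 ?addr0// => i ij.
    by rewrite mxE (f j)// eq_sym (negbTE ij) mulr0.
  by rewrite h -val_eqE/= gtn_eqF.
have [m] := ubnP #|[pred j | (j != l) && (Q l j != 0)]|.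
elim: m Q oQ fQ => [//|m IHm] Q oQ fQ; rewrite ltnS => cQ.
have [[j /andP[jl Qj0]]|noj] := pselect (exists j, (j != l) && (Q l j != 0)); last first.
  have Q0 j : j != l -> Q l j = 0.
    move=> jl; apply/eqP/negPn/negP => Qj; apply: noj; exists j.
    by rewrite jl Qj.
  have /eqP := normQ _ oQ; rewrite (bigD1 l)//= big1 ?addr0; last first.
    by move=> j /Q0 ->; rewrite expr0n.
  rewrite sqrf_eq1 => /orP[/eqP Ql|/eqP Ql].
    by apply: IHk => // j; have [<-|lj] := eqVneq l j; rewrite ?Ql// Q0// eq_sym.
  (* The row is minus a basis vector. With [c = -1] and [s = 0] the reflection only negates column
     [l], so any second coordinate [b] will do, even one whose row is already fixed. *)
  pose b : 'I_n.+2 := if l == ord0 then ord_max else ord0.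
  have lb : l != b by rewrite /b; have [->|] := eqVneq l ord0.
  have cs : (-1) ^+ 2 + 0 ^+ 2 = 1 :> R by rewrite sqrrN expr1n expr0n addr0.
  apply: (SMr _ l b (-1) 0) => //; first by left; rewrite oppr_eq0 oner_eq0.
  apply: IHk; first exact: oM.
    move=> i j il; rewrite mulmx_plane_refl//.
    have li : i == l = false by apply/negbTE; rewrite -val_eqE/= neq_ltn il.
    case: ifP => [/eqP ->|_]; first by rewrite !fQ// li mulr0 mul0r addr0.
    case: ifP => [/eqP ->|_]; last exact: fQ.
    by rewrite !fQ// li mulr0 mulN1r opprK add0r.
  move=> j; rewrite mulmx_plane_refl//.
  have [_|jl] := eqVneq j l; first by rewrite Ql mulrNN mulr1 mul0r addr0.
  have [_|jb] := eqVneq j b; last by rewrite Q0.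
  by rewrite (Q0 b) ?(eq_sym b)// mulr0 mul0r subr0.
pose r := Num.sqrt (Q l l ^+ 2 + Q l j ^+ 2).
have r2 : r ^+ 2 = Q l l ^+ 2 + Q l j ^+ 2 by rewrite sqr_sqrtr// addr_ge0// sqr_ge0.
have r0 : r != 0.
  rewrite -sqrf_eq0 r2 gt_eqF// ltr_wpDl ?sqr_ge0//.
  by rewrite exprn_even_gt0.
(* The pair is chosen to cancel the new entry at [(l, j)]. When [Q l l = 0] a swap of coordinates
   does it, the only reflection with [c = 0] that [SM] admits. *)
have [c [s [cs cP ej]]] : exists c s : R, [/\ c ^+ 2 + s ^+ 2 = 1,
    c != 0 \/ c = 0 /\ s = 1 & s * Q l l - c * Q l j = 0].
  have [Ql0|Ql0] := eqVneq (Q l l) 0.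
    exists 0, 1; split; first by rewrite expr0n expr1n add0r.
    - by right.
    - by rewrite Ql0; ring.
  exists (Q l l / r), (Q l j / r); split.
  - by rewrite !expr_div_n -mulrDl -r2 divff// sqrf_eq0.
  - by left; rewrite mulf_neq0// invr_eq0.
  - by ring.
rewrite eq_sym in jl.
apply: (SMr Q l j c s jl cs cP).
apply: IHm; first exact: oM.
- have jk : (n.+2 - k.+1 < j)%N.
    rewrite ltnNge leq_eqVlt; apply/negP => /orP[/eqP jlE|jlt].
      by move: jl; rewrite -val_eqE/= -jlE eqxx.
    by move/eqP: Qj0; apply; exact: ortQ.
  move=> i j' il; rewrite mulmx_plane_refl//.
  have li : i == l = false by apply/negbTE; rewrite -val_eqE/= neq_ltn il.
  have ij : i == j = false by apply/negbTE; rewrite -val_eqE/= neq_ltn (ltn_trans il).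
  case: ifP => [/eqP ->|_]; first by rewrite !fQ// li ij !mulr0 addr0.
  case: ifP => [/eqP ->|_]; last exact: fQ.
  by rewrite !fQ// li ij !mulr0 subr0.
- apply: leq_trans cQ; apply/proper_card/properP; split.
    apply/fintype.subsetP => i; rewrite !inE => /andP[il Qi].
    apply/andP; split=> //; move: Qi; rewrite mulmx_plane_refl// (negbTE il).
    by case: ifP => [/eqP ->|//]; rewrite ej eqxx.
  exists j; first by rewrite !inE eq_sym jl Qj0.
  by rewrite !inE mulmx_plane_refl// eq_sym (negbTE jl) eqxx ej eqxx.
Qed.

(** * Orthogonal invariance *)

Section gaussian_rows.
Context (R : realType) (d0 : measure_display) (Omega : measurableType d0)
  (P : probability Omega R) (k n : nat).
Implicit Types (u : Omega -> 'rV[R]_n) (w : 'I_k -> Omega -> 'rV[R]_n).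

Definition gauss_rect (A : 'I_k -> 'I_n -> set R) : \bar R :=
  (\big[*%E/1%E]_(i < k) \big[*%E/1%E]_(j < n) normal_prob 0 1 (A i j))%E.

Lemma gauss_rectE A :
  gauss_rect A = (\big[*%E/1%E]_(p : 'I_k * 'I_n) normal_prob 0 1 (A p.1 p.2))%E.
Proof. by rewrite /gauss_rect pair_bigA. Qed.

Lemma indep_std_gaussP u w : indep_std_gauss P u w <->
  forall B A, mx_borel B -> (forall i j, measurable (A i j)) ->
    P (u @^-1` B `&` [set o | forall p, A p.1 p.2 (w p.1 o 0 p.2)]) =
    (P (u @^-1` B) * gauss_rect A)%E.
Proof.
have E A : \bigcap_(i in [set: 'I_k]) \bigcap_(j in [set: 'I_n])
      [set o | A i j (w i o 0 j)] = [set o | forall p, A p.1 p.2 (w p.1 o 0 p.2)].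
  apply/seteqP; split=> o /= h; first by move=> [i j]; exact: h.
  by move=> i _ j _; exact: (h (i, j)).
by split=> h B A mB mA; have := h B A mB mA; rewrite E.
Qed.

Definition set2rect (r : 'I_k) (a b : 'I_n) (A1 A2 : set R) A : 'I_k -> 'I_n -> set R :=
  fun i j => if (i, j) == (r, a) then A1 else if (i, j) == (r, b) then A2 else A i j.

Definition rest_rect (r : 'I_k) (a b : 'I_n) (A : 'I_k -> 'I_n -> set R) : \bar R :=
  (\big[*%E/1%E]_(p : 'I_k * 'I_n | (p != (r, a)) && (p != (r, b)))
     normal_prob 0 1 (A p.1 p.2))%E.

Lemma gauss_rect_set2 r a b A1 A2 A : a != b ->
  gauss_rect (set2rect r a b A1 A2 A) =
  (normal_prob 0 1 A1 * normal_prob 0 1 A2 * rest_rect r a b A)%E.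
Proof.
move=> ab; rewrite gauss_rectE (bigD1 (r, a))//= (bigD1 (r, b))/=; last first.
  by rewrite xpair_eqE eqxx eq_sym.
have ba : (r, b) == (r, a) = false by rewrite xpair_eqE eqxx eq_sym (negbTE ab).
rewrite /set2rect !eqxx ba muleA; congr (_ * _)%E.
by apply: eq_bigr => -[i j] /andP[/negbTE-> /negbTE->].
Qed.

Lemma rest_rect_fin r a b A : (forall i j, measurable (A i j)) ->
  rest_rect r a b A \is a fin_num /\ (0 <= rest_rect r a b A)%E.
Proof.
move=> mA; rewrite /rest_rect; apply: (big_ind (fun x : \bar R => x \is a fin_num /\ (0 <= x)%E)).
- by [].
- by move=> x y [fx x0] [fy y0]; rewrite fin_numM// mule_ge0.
- by move=> p _; split; [apply: fin_num_measure; exact: mA|exact: measure_ge0].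
Qed.

Lemma measurable_row_mul (m : nat) (d : measure_display) (T : measurableType d)
  (X : T -> 'rV[R]_m) (l : nat) (Q : 'M[R]_(m, l)) j :
  (forall i, measurable_fun setT (fun o => X o 0 i)) ->
  measurable_fun setT (fun o => (X o *m Q) 0 j).
Proof.
move=> mX; under eq_fun do rewrite mxE.
by apply: measurable_sum => i; apply: measurable_funM.
Qed.

Definition mul_row (r : 'I_k) (Q : 'M[R]_n) w : 'I_k -> Omega -> 'rV[R]_n :=
  fun i o => if i == r then w i o *m Q else w i o.

Lemma measurable_mul_row r Q w :
  (forall i j, measurable_fun setT (fun o => w i o 0 j)) ->
  forall i j, measurable_fun setT (fun o => mul_row r Q w i o 0 j).
Proof.
move=> mw i j; rewrite /mul_row; by case: (i == r); [exact: measurable_row_mul|exact: mw].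
Qed.

(** Only two coordinates of row [r] are mixed. On the event [E] constraining [u] and all other
    coordinates, the pair has [C] times the planar normal law, as its values on rectangles show, and
    that law is invariant under the reflection. *)
Lemma indep_std_gauss_plane_refl u w (r : 'I_k) (a b : 'I_n) (c s : R) :
  (forall j, measurable_fun setT (fun o => u o 0 j)) ->
  (forall i j, measurable_fun setT (fun o => w i o 0 j)) ->
  a != b -> c ^+ 2 + s ^+ 2 = 1 -> c != 0 \/ c = 0 /\ s = 1 ->
  indep_std_gauss P u w ->
  indep_std_gauss P u (mul_row r (plane_refl a b c s) w).
Proof.
move=> mu mw ab cs cP /indep_std_gaussP hw; apply/indep_std_gaussP => B A mB mA.
have ba : (r, b) == (r, a) = false by rewrite xpair_eqE eqxx eq_sym (negbTE ab).
have muB : measurable (u @^-1` B).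
  by apply: measurable_mx_preimage mB => i j; rewrite ord1; exact: mu.
have m1 i j (A' : set R) : measurable A' -> measurable [set o | A' (w i o 0 j)].
  by move=> mA'; rewrite -[X in measurable X]setTI; exact: mw.
have [C fC C0] : exists2 C, C \is a fin_num & (0 <= C)%E /\
    C = (P (u @^-1` B) * rest_rect r a b A)%E.
  have [f0 ge0] := rest_rect_fin r a b mA.
  exists (P (u @^-1` B) * rest_rect r a b A)%E.
    by rewrite fin_numM// fin_num_measure.
  by rewrite mule_ge0.
move: C0 => [C0 CE].
have gA : gauss_rect A = (normal_prob 0 1 (A r a) * normal_prob 0 1 (A r b) *
    rest_rect r a b A)%E.
  rewrite -gauss_rect_set2//; congr gauss_rect; apply/funext => i; apply/funext => j.
  rewrite /set2rect; case: ifP => [/eqP[-> ->]//|_].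
  by case: ifP => [/eqP[-> ->]//|_].
pose E := u @^-1` B `&` [set o | forall p : 'I_k * 'I_n,
   (if (p != (r, a)) && (p != (r, b)) then A p.1 p.2 else setT) (w p.1 o 0 p.2)].
have mE : measurable E.
  apply: measurableI => //.
  apply: (measurable_forall (F := fun p : 'I_k * 'I_n =>
     [set o | (if (p != (r, a)) && (p != (r, b)) then A p.1 p.2 else setT) (w p.1 o 0 p.2)])).
  by move=> p; apply: m1; case: ifP.
pose phi o := (w r o 0 a, w r o 0 b).
have mphi : measurable_fun setT (phi : Omega -> (measurableTypeR R * measurableTypeR R)%type).
  exact: (measurable_fun_pair (mw r a) (mw r b)).
pose f : {mfun Omega >-> (measurableTypeR R * measurableTypeR R)%type} :=
  HB.pack phi (isMeasurableFun.Build _ _ _ _ _ mphi).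
have nnC : (0 <= fine C)%R by exact: fine_ge0.
pose C' : {nonneg R} := NngNum nnC.
pose N : probability (measurableTypeR R) R := normal_prob 0 1.
have uniq D : measurable D -> (mscale C' N \x N)%E D = P (E `&` phi @^-1` D).
  move=> mD.
  rewrite (@product_measure_unique _ _ _ _ _ (mscale C' N) N (pushforward (mrestr P mE) f))//.
    by rewrite /pushforward /mrestr setIC.
  move=> A1 A2 mA1 mA2; rewrite /pushforward /mrestr /mscale /=.
  rewrite [X in _ = (X * _ * _)%E](_ : _ = C); last exact: fineK.
  rewrite CE.
  have mS i j : measurable (set2rect r a b A1 A2 A i j).
    by rewrite /set2rect; case: ifP => // _; case: ifP.
  transitivity (P (u @^-1` B `&`
    [set o | forall p, set2rect r a b A1 A2 A p.1 p.2 (w p.1 o 0 p.2)])).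
    congr (P _); apply/seteqP; split => o /=.
      move=> [[h1 h2] [uB h]]; split => // -[i j]; have := h (i, j).
      rewrite /= /set2rect.
      have [[-> ->] _|_] := (i, j) =P (r, a); first by [].
      by have [[-> ->] _|_] := (i, j) =P (r, b).
    move=> [uB h]; split; [split|split => //].
    + by have := h (r, a); rewrite /= /set2rect eqxx.
    + by have := h (r, b); rewrite /= /set2rect eqxx ba.
    + move=> [i j]; have := h (i, j); rewrite /= /set2rect.
      by case: eqP => //= _; case: eqP.
  rewrite hw// gauss_rect_set2// -!muleA; congr (_ * _)%E.
  by rewrite muleA muleC.
pose D := [set p : R * R | A r a (c * p.1 + s * p.2) /\ A r b (s * p.1 - c * p.2)].
have mD : measurable D by exact: measurable_rotate_rect.
have ND : (N \x N)%E D = (N (A r a) * N (A r b))%E.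
  (* For [c = 0] the reflection is a swap, which the substitution behind [normal_prob_rotate] does
     not cover. *)
  case: cP => [c0|[c0 s1]]; first exact: normal_prob_rotate.
  have -> : D = A r b `*` A r a.
    by apply/seteqP; split => -[x y]; rewrite /D c0 s1 /= !mul0r !mul1r add0r subr0 => -[].
  by rewrite (product_measure1E N N (mA r b) (mA r a)) muleC.
transitivity (P (E `&` phi @^-1` D)).
  congr (P _); apply/seteqP; split => o /=.
    move=> [uB h]; split; [split => //|].
      move=> [i j]/=; case: ifP => // /andP[ia ib]; have := h (i, j).
      rewrite /= /mul_row; case: eqP => // ir; rewrite mulmx_plane_refl//.
      by move: ia ib; rewrite ir !xpair_eqE eqxx /= => /negbTE -> /negbTE ->.
    split.
      by have := h (r, a); rewrite /= /mul_row eqxx mulmx_plane_refl// eqxx.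
    have := h (r, b); rewrite /= /mul_row eqxx mulmx_plane_refl// eqxx.
    by rewrite eq_sym (negbTE ab).
  move=> [[uB h] [ha hb]]; split => // -[i j]; rewrite /= /mul_row.
  have := h (i, j); rewrite /= !xpair_eqE; case: eqP => [->|//].
  rewrite mulmx_plane_refl//.
  have [ja|ja] := eqVneq j a; first by rewrite ja.
  by have [jb|jb] := eqVneq j b; first by rewrite jb.
rewrite -uniq// /product_measure1 ge0_integral_mscale//=; last exact: measurable_fun_xsection.
rewrite [X in (X * _)%E = _](_ : _ = C); last exact: fineK.
rewrite [X in (_ * X)%E = _]ND CE gA -!muleA; congr (_ * _)%E.
by rewrite muleC muleA.
Qed.

End gaussian_rows.

Section gaussian_orthogonal.
Context (R : realType) (d0 : measure_display) (Omega : measurableType d0)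
  (P : probability Omega R) (k n : nat) (u : Omega -> 'rV[R]_n.+2).
Hypothesis mu : forall j, measurable_fun setT (fun o => u o 0 j).
Implicit Types (w : 'I_k -> Omega -> 'rV[R]_n.+2).

Lemma indep_std_gauss_mul_row (Q : 'M[R]_n.+2) (r : 'I_k) w : orthogonal_mx Q ->
  (forall i j, measurable_fun setT (fun o => w i o 0 j)) ->
  indep_std_gauss P u w -> indep_std_gauss P u (mul_row r Q w).
Proof.
move=> oQ; move: Q oQ w; apply: orthogonal_mx_ind => [w _|Q a b c s ab cs cP IH w mw hw].
  suff -> : mul_row r 1%:M w = w by [].
  by apply/funext => i; apply/funext => o; rewrite /mul_row mulmx1; case: ifP.
have -> : mul_row r (Q *m plane_refl a b c s) w =
    mul_row r (plane_refl a b c s) (mul_row r Q w).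
  by apply/funext => i; apply/funext => o; rewrite /mul_row mulmxA; case: eqP.
apply: indep_std_gauss_plane_refl => //; first exact: measurable_mul_row.
exact: IH.
Qed.

Lemma indep_std_gauss_mul (Q : 'M[R]_n.+2) w : orthogonal_mx Q ->
  (forall i j, measurable_fun setT (fun o => w i o 0 j)) ->
  indep_std_gauss P u w -> indep_std_gauss P u (fun i o => w i o *m Q).
Proof.
move=> oQ mw hw.
(* In [W m] the first [m] rows are multiplied by [Q], so that the step from [m] to [m.+1] changes a
   single row. *)
pose W m (i : 'I_k) o := if (i < m)%N then w i o *m Q else w i o.
suff H m : (m <= k)%N -> (forall i j, measurable_fun setT (fun o => W m i o 0 j)) /\
    indep_std_gauss P u (W m).
  have [_] := H k (leqnn _).
  suff -> : W k = (fun i o => w i o *m Q) by [].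
  by apply/funext => i; apply/funext => o; rewrite /W ltn_ord.
elim: m => [_|m IH mk]; first by split.
have [mW iW] := IH (ltnW mk).
have -> : W m.+1 = mul_row (Ordinal mk) Q (W m).
  apply/funext => i; apply/funext => o; rewrite /mul_row /W ltnS leq_eqVlt -val_eqE/=.
  by case: ltngtP.
split; first exact: measurable_mul_row.
exact: indep_std_gauss_mul_row.
Qed.

End gaussian_orthogonal.

Definition stack_mx (R : realType) (T : Type) (k n : nat) (u : T -> 'rV[R]_n)
    (w : 'I_k -> T -> 'rV[R]_n) (o : T) : 'M[R]_(1 + k, n) :=
  col_mx (u o) (\matrix_i w i o).

Lemma stack_mx_mul (R : realType) (T : Type) (k n : nat) (u : T -> 'rV[R]_n)
    (w : 'I_k -> T -> 'rV[R]_n) (o : T) (Q : 'M[R]_n) :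
  stack_mx u w o *m Q = stack_mx (fun o => u o *m Q) (fun i o => w i o *m Q) o.
Proof.
rewrite /stack_mx mul_col_mx; congr col_mx.
by apply/row_matrixP => i; rewrite row_mul !rowK.
Qed.

Lemma stack_mx_rect (R : realType) (T : Type) (k n : nat) (u : T -> 'rV[R]_n)
    (w : 'I_k -> T -> 'rV[R]_n) (A : 'I_(1 + k) -> 'I_n -> set R) :
  stack_mx u w @^-1` mx_rect A =
  u @^-1` mx_rect (fun _ : 'I_1 => A (lshift k ord0)) `&`
  [set o | forall p, A (rshift 1 p.1) p.2 (w p.1 o 0 p.2)].
Proof.
apply/seteqP; split => o /=.
  move=> h; split=> -[i j]; rewrite /= ?(ord1 i).
    by have := h (lshift k ord0, j); rewrite /= /stack_mx col_mxEu.
  by have := h (rshift 1 i, j); rewrite /= /stack_mx col_mxEd mxE.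
move=> [h1 h2] [i j] /=; rewrite /stack_mx.
case: (split_ordP i) => l ->.
  by have := h1 (ord0, j); rewrite (ord1 l) col_mxEu.
by have := h2 (l, j); rewrite col_mxEd mxE.
Qed.

Lemma measurable_stack_mx (R : realType) (d0 : measure_display)
    (Omega : measurableType d0) (k n : nat) (u : Omega -> 'rV[R]_n)
    (w : 'I_k -> Omega -> 'rV[R]_n) :
  (forall j, measurable_fun setT (fun o => u o 0 j)) ->
  (forall i j, measurable_fun setT (fun o => w i o 0 j)) ->
  measurable_mx (stack_mx u w).
Proof.
move=> mu mw; apply: measurable_mx_col_mx => i j; first by rewrite ord1; exact: mu.
by under eq_fun do rewrite mxE; exact: mw.
Qed.

Section stacked_law.
Context (R : realType) (d0 : measure_display) (Omega : measurableType d0)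
  (P : probability Omega R) (k n : nat) (u : Omega -> 'rV[R]_n.+2)
  (w : 'I_k -> Omega -> 'rV[R]_n.+2).
Hypothesis mu : forall j, measurable_fun setT (fun o => u o 0 j).
Hypothesis mw : forall i j, measurable_fun setT (fun o => w i o 0 j).
Hypothesis hw : indep_std_gauss P u w.

(** On rectangles independence splits the law into that of [u], invariant by uniformity, and the
    Gaussian one; multiplying the [w i] alone by [Q] keeps them standard and independent of the same
    [u]. *)
Lemma stack_mx_law_orthogonal Q B : uniform_on_sphere P u ->
  orthogonal_mx Q -> mx_borel B ->
  P (stack_mx u w @^-1` B) = P ((fun o => stack_mx u w o *m Q) @^-1` B).
Proof.
move=> [_ uQ] oQ; move: B.
have mQ m (X : Omega -> 'M[R]_(m, n.+2)) : measurable_mx X ->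
    measurable_mx (fun o => X o *m Q) by move=> mX; exact: measurable_mx_mul.
apply: eq_law_mx; [exact: measurable_stack_mx|exact/mQ/measurable_stack_mx|].
move=> A mA.
under [in RHS]eq_fun do rewrite stack_mx_mul.
rewrite !stack_mx_rect.
pose B0 := mx_rect (fun _ : 'I_1 => A (lshift k ord0)).
have mB0 : mx_borel B0 by exact: mx_borel_rect.
have mB1 : mx_borel [set v : 'rV[R]_n.+2 | B0 (v *m Q)].
  apply: (@measurable_mx_preimage R _ (mxT R 1 n.+2) 1 n.+2 (fun v => v *m Q)) => //.
  apply: measurable_mx_mul => //; exact: measurable_mx_id.
have /indep_std_gaussP h := hw.
have /indep_std_gaussP hQ := indep_std_gauss_mul mu oQ mw hw.
pose A1 i := A (rshift 1 i).
have mA1 i j : measurable (A1 i j) by exact: mA.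
transitivity (P (u @^-1` B0) * gauss_rect A1)%E; first exact: (h _ A1 mB0).
rewrite (uQ _ oQ _ mB0); apply/esym; exact: (hQ _ A1 mB1).
Qed.

End stacked_law.

(** * Almost sure invertibility *)

Definition upd_mx (R : realType) (m n : nat) (M : 'M[R]_(m, n)) i0 j0 (x : R) : 'M[R]_(m, n) :=
  \matrix_(i, j) if (i, j) == (i0, j0) then x else M i j.

(** Indexing through [inord] lets [m] be a plain number in inductions; the value is a leading
    principal minor for [m <= n.+1] only. *)
Definition lead_minor (R : realType) (n : nat) (m : nat) (M : 'M[R]_n.+1) : R :=
  \det (\matrix_(i < m, j < m) M (inord i) (inord j)).

Lemma lead_minorT (R : realType) (n : nat) (M : 'M[R]_n.+1) :
  lead_minor n.+1 M = \det M.
Proof.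
by congr (\det _); apply/matrixP => i j; rewrite mxE !inord_val.
Qed.

Lemma lead_minor1 (R : realType) (n : nat) (M : 'M[R]_n.+1) :
  lead_minor 1 M = M ord0 ord0.
Proof.
rewrite /lead_minor det_mx11 mxE.
by congr (M _ _); apply/val_inj; rewrite /= inordK.
Qed.

Lemma lead_minor_upd (R : realType) (n m : nat) (M : 'M[R]_n.+1) (x : R) :
  (m < n.+1)%N -> lead_minor m (upd_mx M (inord m) (inord m) x) = lead_minor m M.
Proof.
move=> mn; congr (\det _); apply/matrixP => i j; rewrite !mxE.
case: eqP => // -[/(congr1 val)/=]; rewrite !inordK//; last first.
  exact: ltn_trans (ltn_ord i) mn.
by move=> im; have := ltn_ord i; rewrite im ltnn.
Qed.

(** Expansion along the last row: the cofactor of the corner is the minor one size down, and no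
    cofactor of this row involves the corner. *)
Lemma lead_minorS_upd (R : realType) (n m : nat) (M : 'M[R]_n.+1) (x : R) :
  (m < n.+1)%N -> lead_minor m.+1 (upd_mx M (inord m) (inord m) x) =
    x * lead_minor m M + lead_minor m.+1 (upd_mx M (inord m) (inord m) 0).
Proof.
move=> mn; rewrite /lead_minor.
set A := \matrix_(i < m.+1, j < m.+1) _; set A0 := \matrix_(i < m.+1, j < m.+1) upd_mx _ _ _ 0 _ _.
have neq (i : 'I_m) (j : 'I_m.+1) :
    (inord (lift ord_max i), inord j) == (inord m, inord m) :> 'I_n.+1 * 'I_n.+1 = false.
  apply/eqP => -[/(congr1 val)/= + _]; rewrite !inordK//; last first.
    by apply: leq_trans mn; exact: (ltn_ord (lift ord_max i)).
  by rewrite /bump leqNgt ltn_ord add0n => im; have := ltn_ord i; rewrite im ltnn.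
have cof j : cofactor A ord_max j = cofactor A0 ord_max j.
  congr (_ * \det _); apply/matrixP => a b; rewrite !mxE.
  by rewrite !neq.
have cofmm : cofactor A0 ord_max ord_max = \det (\matrix_(i < m, j < m) M (inord i) (inord j)).
  rewrite /cofactor -signr_odd oddD addbb expr0 mul1r.
  congr (\det _); apply/matrixP => a b; rewrite !mxE neq.
  by congr (M _ _); apply/val_inj; rewrite /= /bump leqNgt ltn_ord.
rewrite !(expand_det_row _ ord_max) !big_ord_recr/= cof cofmm.
have -> : A ord_max ord_max = x by rewrite !mxE eqxx.
have -> : A0 ord_max ord_max = 0 by rewrite !mxE eqxx.
rewrite mul0r addr0 addrC; congr (_ + _).
apply: eq_bigr => i _; rewrite cof; congr (_ * _); rewrite !mxE.
case: eqP => // /(congr1 (fun p => val p.2)) /=; rewrite !inordK//; last first.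
  by apply: ltn_trans mn; exact: ltn_ord.
by move=> im; have := ltn_ord i; rewrite im ltnn.
Qed.

Lemma normal_prob_set1 (R : realType) (m s x : R) : normal_prob m s [set x] = 0%E.
Proof. exact: integral_set1. Qed.

Section nonsingular.
Context (R : realType) (d0 : measure_display) (Omega : measurableType d0)
  (P : probability Omega R).

(** A Gaussian entry is independent of all the others, so an independent copy may replace it. On the
    product space it can then be integrated while the rest of the matrix is frozen. *)
Lemma stack_mx_resample (k n : nat) (u : Omega -> 'rV[R]_n)
    (w : 'I_k -> Omega -> 'rV[R]_n) (r : 'I_k) (b : 'I_n) B :
  (forall j, measurable_fun setT (fun o => u o 0 j)) ->
  (forall i j, measurable_fun setT (fun o => w i o 0 j)) ->
  indep_std_gauss P u w -> mx_borel B ->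
  P (stack_mx u w @^-1` B) =
  (P \x P)%E [set p | B (upd_mx (stack_mx u w p.1) (rshift 1 r) b (w r p.2 0 b))].
Proof.
move=> mu mw /indep_std_gaussP hw.
pose Y (p : Omega * Omega) := upd_mx (stack_mx u w p.1) (rshift 1 r) b (w r p.2 0 b).
have mM := measurable_stack_mx mu mw.
have mY : measurable_mx Y.
  move=> i j; under eq_fun do rewrite mxE.
  case: eqP => _; first exact: (measurableT_comp (mw r b) measurable_snd).
  exact: (measurableT_comp (mM i j) measurable_fst).
rewrite (_ : mkset _ = Y @^-1` B)//; move: B.
apply: (eq_law_mx (mu1 := P) (mu2 := (P \x P)%E) (Y := Y) mM mY) => A mA.
(* Freeing the resampled entry makes the event a product of one event in each copy of [Omega]. *)
pose A' i j := if (i, j) == (rshift 1 r, b) then setT else A i j.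
have mA' i j : measurable (A' i j) by rewrite /A'; case: ifP.
have -> : Y @^-1` mx_rect A = (stack_mx u w @^-1` mx_rect A') `*`
     [set o | A (rshift 1 r) b (w r o 0 b)].
  apply/seteqP; split => -[a1 a2] /=.
    move=> h; split; last by have := h (rshift 1 r, b); rewrite /= mxE eqxx.
    move=> [i j]; have := h (i, j); rewrite /= mxE /A'; by case: eqP.
  move=> [h1 h2] [i j]; rewrite /= mxE; have := h1 (i, j); rewrite /= /A'.
  by case: eqP => [[-> ->]|].
have mX : measurable (stack_mx u w @^-1` mx_rect A').
  by apply: measurable_mx_preimage => //; exact: mx_borel_rect.
have mw' : measurable [set o | A (rshift 1 r) b (w r o 0 b)].
  by rewrite -[X in measurable X]setTI; exact: mw.
transitivity (P (stack_mx u w @^-1` mx_rect A') *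
  P [set o | A (rshift 1 r) b (w r o 0%R b)])%E; last exact/esym/product_measure1E.
rewrite !stack_mx_rect.
have N1 : P [set o | A (rshift 1 r) b (w r o 0 b)] = normal_prob 0 1 (A (rshift 1 r) b).
  have mT : mx_borel [set: 'rV[R]_n] by exact: (@measurableT _ (mxT R 1 n)).
  pose A'' i j := if (i, j) == (r, b) then A (rshift 1 r) b else setT.
  have := hw _ A'' mT; rewrite preimage_setT setTI probability_setT mul1e.
  rewrite gauss_rectE (bigD1 (r, b))//= big1 ?mule1; last first.
    by move=> [i j] /negbTE ij; rewrite /A'' ij probability_setT.
  rewrite {3}/A'' eqxx => <-; last by move=> i j; rewrite /A''; case: ifP.
  congr (P _); apply/seteqP; split => o /=; rewrite /A''.
    by move=> h [i j] /=; case: eqP => // -[-> ->].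
  by move=> /(_ (r, b)) /=; rewrite eqxx.
rewrite N1.
have mB0 : mx_borel (mx_rect (fun _ : 'I_1 => A (lshift k ord0))) by exact: mx_borel_rect.
have eA : A' (lshift k ord0) = A (lshift k ord0).
  by apply/funext => j; rewrite /A'; case: eqP => // -[].
rewrite eA.
pose A1 i := A (rshift 1 i); pose A1' i := A' (rshift 1 i).
have mA1 i j : measurable (A1 i j) by exact: mA.
have mA1' i j : measurable (A1' i j) by exact: mA'.
transitivity (P (u @^-1` mx_rect (fun=> A (lshift k ord0))) * gauss_rect A1)%E.
  exact: (hw _ A1 mB0).
transitivity (P (u @^-1` mx_rect (fun=> A (lshift k ord0))) * gauss_rect A1' *
  normal_prob 0 1 (A (rshift 1 r) b))%E; last first.
  by congr (_ * _)%E; apply/esym; exact: (hw _ A1' mB0).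
rewrite -muleA; congr (_ * _)%E; rewrite !gauss_rectE.
rewrite (bigD1 (r, b))//= [in RHS](bigD1 (r, b))//=.
have -> : A1' r b = setT by rewrite /A1' /A' eqxx.
rewrite probability_setT mul1e muleC; congr (_ * _)%E.
apply: eq_bigr => -[i j] /= ij; congr normal_prob; rewrite /A1' /A'.
by case: eqP => // -[ir jb]; rewrite jb (val_inj (ir : val i = val r)) eqxx in ij.
Qed.

Context (n : nat) (u : Omega -> 'rV[R]_n.+2) (w : 'I_n.+1 -> Omega -> 'rV[R]_n.+2).
Hypothesis mu : forall j, measurable_fun setT (fun o => u o 0 j).
Hypothesis mw : forall i j, measurable_fun setT (fun o => w i o 0 j).
Hypothesis hu : uniform_on_sphere P u.
Hypothesis hw : indep_std_gauss P u w.
Let M (o : Omega) : 'M[R]_n.+2 := stack_mx u w o.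

Lemma mx_borel_lead_minor m :
  mx_borel [set M : 'M[R]_n.+2 | lead_minor m M = 0].
Proof.
apply: (_ : measurable ([set M | lead_minor m M = 0] : set (mxT R n.+2 n.+2))).
rewrite -[X in measurable X]setTI.
rewrite (_ : mkset _ = (fun M : mxT R n.+2 n.+2 => lead_minor m M) @^-1` [set 0])//.
have : measurable_fun setT (fun M : mxT R n.+2 n.+2 => lead_minor m M).
  apply: measurable_det => i j; under eq_fun do rewrite mxE.
  exact: measurable_mx_id.
by apply.
Qed.

(** With all entries but the corner frozen, the larger minor is affine in the corner with nonzero
    slope. It vanishes at a single value, which a normal variable takes with probability 0. *)
Lemma lead_minorS_null m : (0 < m)%N -> (m < n.+2)%N ->
  P [set o | lead_minor m (M o) <> 0 /\ lead_minor m.+1 (M o) = 0] = 0%E.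
Proof.
move=> m0 mn.
pose B : set 'M[R]_n.+2 := ~` [set M | lead_minor m M = 0] `&` [set M | lead_minor m.+1 M = 0].
have mB : mx_borel B.
  apply: (@measurableI _ (mxT R n.+2 n.+2)); last exact: mx_borel_lead_minor.
  by apply: (@measurableC _ (mxT R n.+2 n.+2)); exact: mx_borel_lead_minor.
(* Row 0 of the stack is [u], so row [m] is row [m.-1] of [w]; this requires [0 < m]. *)
have mn' : (m.-1 < n.+1)%N by rewrite prednK.
have := stack_mx_resample (Ordinal mn') (inord m) mu mw hw mB.
have -> : rshift 1 (Ordinal mn') = inord m :> 'I_n.+2.
  by apply/val_inj; rewrite /= inordK// add1n prednK.
move=> /= ->; apply: integral0_eq => o1 _ /=.
set S := xsection _ _.
have -> : S = [set o2 | B (upd_mx (M o1) (inord m) (inord m) (w (Ordinal mn') o2 0 (inord m)))].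
  by apply/seteqP; split => o2; rewrite /S /xsection /= inE.
have [D0|D0] := eqVneq (lead_minor m (M o1)) 0.
  rewrite (_ : mkset _ = set0) ?measure0//; apply/seteqP; split => o2 //=.
  by move=> [h _]; apply: h; rewrite /= lead_minor_upd//.
set c := lead_minor m.+1 (upd_mx (M o1) (inord m) (inord m) 0).
apply/eqP; rewrite eq_le measure_ge0 andbT.
pose A i j : set R := if (i, j) == (Ordinal mn', inord m : 'I_n.+2)
  then [set - c / lead_minor m (M o1)] else setT.
have mT : mx_borel [set: 'rV[R]_n.+2] by exact: (@measurableT _ (mxT R 1 n.+2)).
have mA i j : measurable (A i j) by rewrite /A; case: ifP.
have /indep_std_gaussP hw' := hw.
have := hw' _ A mT mA; rewrite preimage_setT setTI.
rewrite gauss_rectE (bigD1 (Ordinal mn', inord m))//= {2}/A eqxx normal_prob_set1 mul0e mule0 => <-.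
apply: le_measure; rewrite ?inE.
- have mU : measurable_mx (fun o2 =>
      upd_mx (M o1) (inord m) (inord m) (w (Ordinal mn') o2 0 (inord m))).
    by move=> i j; under eq_fun do rewrite mxE; case: eqP => _; [exact: mw|exact: measurable_cst].
  exact: (measurable_mx_preimage mU mB).
- apply: (measurable_forall (F := fun p => [set o | A p.1 p.2 (w p.1 o 0 p.2)])) => p.
  by rewrite -[X in measurable X]setTI; exact: mw.
move=> o2 /= [_] /=; rewrite lead_minorS_upd// -/c => /eqP; rewrite addr_eq0 => /eqP h.
move=> [i j]; rewrite /A /=; case: eqP => // -[-> ->] /=.
by rewrite -h mulfK.
Qed.

(** The chain of minors starts at the first coordinate of [u], so it first gives the claim where
    this coordinate is nonzero. Permuting columns is orthogonal and brings any other coordinate to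
    the front, and a unit vector has a nonzero coordinate. *)
Lemma det_stack_mx_neq0 : P [set o | \det (M o) = 0] = 0%E.
Proof.
have mM : measurable_mx M := measurable_stack_mx mu mw.
have mD m : measurable [set o | lead_minor m (M o) = 0].
  exact: (measurable_mx_preimage mM (mx_borel_lead_minor m)).
have mC1 : measurable [set o | M o ord0 ord0 <> 0].
  have -> : [set o | M o ord0 ord0 <> 0] = ~` [set o | lead_minor 1 (M o) = 0].
    by apply/seteqP; split => o /=; rewrite lead_minor1.
  exact: measurableC.
have H m : (0 < m)%N -> (m <= n.+2)%N ->
    P [set o | M o ord0 ord0 <> 0 /\ lead_minor m (M o) = 0] = 0%E.
  elim: m => // -[|m] IH _ mn.
    rewrite (_ : mkset _ = set0) ?measure0//; apply/seteqP; split => o //=.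
    by rewrite lead_minor1 => -[].
  apply/eqP; rewrite eq_le measure_ge0 andbT.
  rewrite -[leRHS](adde0 0%E) -{1}(IH isT (ltnW mn)) -(lead_minorS_null (m := m.+1))//.
  have m1 : measurable [set o | M o ord0 ord0 <> 0 /\ lead_minor m.+1 (M o) = 0].
    by apply: measurableI; [exact: mC1|exact: mD].
  have m2 : measurable [set o | lead_minor m.+1 (M o) <> 0 /\ lead_minor m.+2 (M o) = 0].
    by apply: measurableI; [exact: (measurableC (mD m.+1))|exact: mD].
  apply: le_trans (measureU2 _ m1 m2).
  apply: le_measure; rewrite ?inE.
  - by apply: measurableI; [exact: mC1|exact: mD].
  - exact: measurableU.
  move=> o /= [h1 h2].
  by have [h|h] := eqVneq (lead_minor m.+1 (M o)) 0; [left|right; split => //; exact/eqP].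
have {}H : P [set o | M o ord0 ord0 <> 0 /\ \det (M o) = 0] = 0%E.
  rewrite -[RHS](H n.+2)//; congr (P _).
  by apply/seteqP; split => o /=; rewrite lead_minorT.
pose B : set 'M[R]_n.+2 := ~` [set M | lead_minor 1 M = 0] `&` [set M | lead_minor n.+2 M = 0].
have mB : mx_borel B.
  apply: (@measurableI _ (mxT R n.+2 n.+2)); last exact: mx_borel_lead_minor.
  by apply: (@measurableC _ (mxT R n.+2 n.+2)); exact: mx_borel_lead_minor.
pose C j := [set o | u o 0 j <> 0 /\ \det (M o) = 0].
have mdet : measurable [set o | \det (M o) = 0].
  rewrite (_ : mkset _ = [set o | lead_minor n.+2 (M o) = 0]); first exact: mD.
  by apply/seteqP; split => o /=; rewrite lead_minorT.
have mC j : measurable (C j).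
  apply: measurableI; last exact: mdet.
  apply: measurableC; rewrite -[X in measurable X]setTI.
  by apply: (mu j measurableT (Y := [set 0])).
have C0 j : P (C j) = 0%E.
  pose Q : 'M[R]_n.+2 := tperm_mx ord0 j.
  have oQ : orthogonal_mx Q.
    by rewrite /orthogonal_mx tr_tperm_mx -perm_mxM perm.tperm2 perm_mx1.
  have := stack_mx_law_orthogonal mu mw hw hu oQ mB.
  rewrite (_ : _ @^-1` B = [set o | M o ord0 ord0 <> 0 /\ \det (M o) = 0]); last first.
    by apply/seteqP; split => o; rewrite /B /= lead_minor1 lead_minorT.
  rewrite H => ->; congr (P _).
  have dQ : \det Q != 0.
    apply/eqP => dQ; move/(congr1 determinant): oQ; rewrite det_mulmx det1 dQ mul0r.
    by move/eqP; rewrite eq_sym oner_eq0.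
  have u0 o : (stack_mx u w o *m Q) ord0 ord0 = u o 0 j.
    rewrite /Q -xcolE mxE perm.tpermL /stack_mx.
    rewrite -[RHS](col_mxEu _ (\matrix_i w i o)).
    by congr (col_mx _ _ _ _); exact: val_inj.
  apply/seteqP; split => o; rewrite /B /C /= lead_minor1 lead_minorT det_mulmx u0.
    by move=> [h1 h2]; split => //; rewrite -/(M o) h2 mul0r.
  move=> [h1 /eqP]; rewrite mulf_eq0 (negbTE dQ) orbF => /eqP h2; split => //.
apply/negligibleP => //.
apply: (negligibleS (A := \bigcup_i C (inord i))); last first.
  by apply: negligible_bigcup => i; apply/negligibleP; [exact: mC|exact: C0].
move=> o /= dM0.
have [j uj] : exists j, u o 0 j <> 0.
  apply: contrapT => h; have [uS _] := hu.
  have := uS o; have -> : u o = 0.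
    by apply/rowP => j; rewrite mxE; apply: contrapT => uj; apply: h; exists j.
  by rewrite /on_sphere mul0mx => /matrixP /(_ 0 0); rewrite !mxE eqxx => /esym/eqP;
    rewrite oner_eq0.
by exists (val j) => //; rewrite inord_val.
Qed.

End nonsingular.

(** * Gram-Schmidt orthogonalization *)

Definition sqnorm (R : realType) (n : nat) (v : 'rV[R]_n) : R := (v *m v^T) 0 0.

Lemma sqnormE (R : realType) (n : nat) (v : 'rV[R]_n) :
  v *m v^T = (sqnorm v)%:M.
Proof. exact: mx11_scalar. Qed.

Lemma sqnorm_ge0 (R : realType) (n : nat) (v : 'rV[R]_n) : 0 <= sqnorm v.
Proof.
by rewrite /sqnorm mxE; apply: sumr_ge0 => i _; rewrite mxE -expr2 sqr_ge0.
Qed.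

Lemma sqnorm_eq0 (R : realType) (n : nat) (v : 'rV[R]_n) :
  (sqnorm v == 0) = (v == 0).
Proof.
apply/idP/eqP => [|->]; last by rewrite /sqnorm mul0mx mxE.
rewrite /sqnorm mxE psumr_eq0; last by move=> i _; rewrite mxE -expr2 sqr_ge0.
move=> /allP h; apply/rowP => j; have := h j (mem_index_enum _).
by rewrite !mxE -expr2 sqrf_eq0 => /eqP.
Qed.

Section gram_schmidt.
Context (R : realType) (n : nat).
Implicit Types (M Q : 'M[R]_n.+1).

(** For [k <= n.+1], the orthogonal projection onto the span of the first [k] rows. A dependent row
    has [v = 0] and adds nothing, as the inverse of 0 is 0. Working with projections makes
    equivariance a conjugation. *)
Fixpoint gs_proj M (k : nat) : 'M[R]_n.+1 :=
  if k is k'.+1 then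
    let v := row (inord k') M *m (1%:M - gs_proj M k') in
    gs_proj M k' + (sqnorm v)^-1 *: (v^T *m v)
  else 0.

Definition gs_vec M (k : nat) : 'rV[R]_n.+1 :=
  row (inord k) M *m (1%:M - gs_proj M k).

Definition gs_mx M : 'M[R]_n.+1 :=
  \matrix_i ((Num.sqrt (sqnorm (gs_vec M i)))^-1 *: gs_vec M i).

Lemma gs_projS M k : gs_proj M k.+1 =
  gs_proj M k + (sqnorm (gs_vec M k))^-1 *: ((gs_vec M k)^T *m gs_vec M k).
Proof. by []. Qed.

Lemma sqnorm_mul m (v : 'rV[R]_m) (Q : 'M[R]_m) : orthogonal_mx Q ->
  sqnorm (v *m Q) = sqnorm v.
Proof. by move=> oQ; rewrite /sqnorm trmx_mul mulmxA -(mulmxA v) oQ mulmx1. Qed.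

Lemma gs_vec_proj_mul M Q k : orthogonal_mx Q ->
  gs_proj (M *m Q) k = Q^T *m gs_proj M k *m Q ->
  gs_vec (M *m Q) k = gs_vec M k *m Q.
Proof.
move=> oQ eP; rewrite /gs_vec eP row_mul !mulmxBr !mulmxBl !mulmx1 !mulmxA.
by rewrite -(mulmxA _ Q Q^T) oQ mulmx1.
Qed.

Lemma gs_proj_mul M Q k : orthogonal_mx Q ->
  gs_proj (M *m Q) k = Q^T *m gs_proj M k *m Q.
Proof.
move=> oQ; elim: k => [|k IH]; first by rewrite /= mulmx0 mul0mx.
rewrite !gs_projS IH (gs_vec_proj_mul oQ IH) sqnorm_mul// mulmxDr mulmxDl.
by rewrite -scalemxAr -scalemxAl trmx_mul !mulmxA.
Qed.

(** This equivariance is what makes the factor of an orthogonally invariant matrix Haar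
    distributed. *)
Lemma gs_mx_mul M Q : orthogonal_mx Q -> gs_mx (M *m Q) = gs_mx M *m Q.
Proof.
move=> oQ; apply/row_matrixP => i; rewrite row_mul !rowK.
by rewrite (gs_vec_proj_mul oQ (gs_proj_mul _ _ oQ)) sqnorm_mul// scalemxAl.
Qed.

Lemma gs_proj_tr M k : (gs_proj M k)^T = gs_proj M k.
Proof.
elim: k => [|k IH]; first by rewrite trmx0.
by rewrite gs_projS linearD linearZ /= trmx_mul trmxK IH.
Qed.

Lemma gs_proj_idem M k : gs_proj M k *m gs_proj M k = gs_proj M k.
Proof.
elim: k => [|k IH]; first by rewrite mul0mx.
have vP : gs_vec M k *m gs_proj M k = 0.
  by rewrite /gs_vec -mulmxA mulmxBl mul1mx IH subrr mulmx0.
have Pv : gs_proj M k *m (gs_vec M k)^T = 0.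
  by apply: trmx_inj; rewrite trmx_mul trmxK gs_proj_tr vP trmx0.
rewrite gs_projS mulmxDl !mulmxDr IH -!scalemxAr -!scalemxAl.
rewrite mulmxA Pv mul0mx scaler0 addr0 -mulmxA vP mulmx0 scaler0 add0r.
congr (_ + _); rewrite mulmxA -(mulmxA _ (gs_vec M k) _) sqnormE.
rewrite mul_mx_scalar -scalemxAl !scalerA -mulrA.
have [->|s0] := eqVneq (sqnorm (gs_vec M k)) 0; first by rewrite invr0 !mul0r.
by rewrite mulVf// mulr1.
Qed.

Lemma gs_vec_proj M k : gs_vec M k *m gs_proj M k = 0.
Proof. by rewrite /gs_vec -mulmxA mulmxBl mul1mx gs_proj_idem subrr mulmx0. Qed.

Lemma gs_vec_proj_gt M j k : (j < k)%N -> gs_vec M j *m gs_proj M k = gs_vec M j.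
Proof.
elim: k => // k IH; rewrite ltnS leq_eqVlt => /orP[/eqP <-|jk].
  rewrite gs_projS mulmxDr gs_vec_proj add0r -scalemxAr mulmxA sqnormE mul_scalar_mx scalerA.
  have [s0|s0] := eqVneq (sqnorm (gs_vec M j)) 0; last by rewrite mulVf// scale1r.
  by move/eqP: (s0); rewrite sqnorm_eq0 => /eqP ->; rewrite scaler0.
have vv : gs_vec M j *m (gs_vec M k)^T = 0.
  rewrite -(IH jk) -mulmxA -{1}(gs_proj_tr M k) -trmx_mul gs_vec_proj.
  by rewrite trmx0 mulmx0.
by rewrite gs_projS mulmxDr (IH jk) -scalemxAr mulmxA vv mul0mx scaler0 addr0.
Qed.

Lemma gs_vec_orth M j k : (j < k)%N -> gs_vec M j *m (gs_vec M k)^T = 0.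
Proof.
move=> jk; rewrite -(gs_vec_proj_gt M jk) -mulmxA -{1}(gs_proj_tr M k) -trmx_mul.
by rewrite gs_vec_proj trmx0 mulmx0.
Qed.

(** The residual is row [k] minus a combination of earlier rows, hence [c *m M] with coefficient 1
    at [k]; were it zero, invertibility would force [c = 0]. *)
Lemma gs_vec_neq0 M k : (k < n.+1)%N -> M \in unitmx -> gs_vec M k != 0.
Proof.
move=> kn uM.
(* The vanishing columns of [C] say that the projection uses only the rows of [M] before [m]. *)
pose coef m (C : 'M[R]_n.+1) := gs_proj M m = C *m M /\
  forall i (j : 'I_n.+1), (m <= j)%N -> C i j = 0.
have vecE m C : (m < n.+1)%N -> coef m C -> exists c : 'rV[R]_n.+1,
    [/\ gs_vec M m = c *m M, c 0 (inord m) = 1 & forall j : 'I_n.+1, (m < j)%N -> c 0 j = 0].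
  move=> mn [eP C0]; exists (delta_mx 0 (inord m) - row (inord m) M *m C).
  have rC (j : 'I_n.+1) : (m <= j)%N -> (row (inord m) M *m C) 0 j = 0.
    by move=> mj; rewrite mxE big1// => i _; rewrite C0// mulr0.
  split.
  - by rewrite /gs_vec eP mulmxBr mulmx1 mulmxBl -rowE mulmxA.
  - by rewrite mxE [X in _ + X]mxE rC ?inordK// subr0 mxE !eqxx.
  - move=> j mj; rewrite mxE [X in _ + X]mxE rC ?(ltnW mj)// subr0 mxE eqxx /=.
    by rewrite -val_eqE /= inordK// gtn_eqF.
have [C PC] : exists C, coef k C.
  elim: k kn => [_|k IH kn].
    by exists 0; split; [rewrite mul0mx|move=> i j _; rewrite mxE].
  have [C PC] := IH (ltnW kn); have [c [vc _ c0]] := vecE _ _ (ltnW kn) PC.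
  case: PC => eP C0.
  exists (C + (sqnorm (gs_vec M k))^-1 *: ((gs_vec M k)^T *m c)); split.
    by rewrite gs_projS eP mulmxDl -scalemxAl -mulmxA {3}vc.
  move=> i j kj; rewrite mxE C0 ?(ltnW kj)// add0r mxE mxE big1 ?mulr0// => l _.
  by rewrite (ord1 l) c0// mulr0.
have [c [-> c1 _]] := vecE _ _ kn PC.
apply/eqP => cM; have c0 : c = 0 by rewrite -(mulmxK uM c) cM mul0mx.
by move/eqP: c1; rewrite c0 mxE eq_sym oner_eq0.
Qed.

Lemma gs_mx_orthogonal M : M \in unitmx -> orthogonal_mx (gs_mx M).
Proof.
move=> uM; apply/matrixP => i j; rewrite mxE.
transitivity ((row i (gs_mx M) *m (row j (gs_mx M))^T) 0 0).
  by rewrite mxE; apply: eq_bigr => l _; rewrite !mxE.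
rewrite !rowK linearZ /= -scalemxAr -scalemxAl scalerA.
have [<-|ij] := eqVneq i j.
  rewrite mxE [X in _ * X = _](_ : _ = sqnorm (gs_vec M i))// mxE eqxx -invfM -expr2.
  by rewrite sqr_sqrtr ?sqnorm_ge0// mulVf// sqnorm_eq0 gs_vec_neq0.
rewrite [RHS]mxE (negbTE ij).
move: ij; rewrite -val_eqE neq_ltn => /orP[ij|ji].
  by rewrite gs_vec_orth// scaler0 mxE.
by rewrite -[_ *m _]trmxK trmx_mul trmxK gs_vec_orth// trmx0 scaler0 mxE.
Qed.

Lemma measurable_gs_mx (d : measure_display) (T : measurableType d)
    (X : T -> 'M[R]_n.+1) :
  measurable_mx X -> measurable_mx (fun o => gs_mx (X o)).
Proof.
move=> mX.
have msq (v : T -> 'rV[R]_n.+1) : measurable_mx v -> measurable_fun setT (fun o => sqnorm (v o)).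
  by move=> mv; apply: (measurable_mx_mul mv (measurable_mx_tr mv)).
have mvec k : measurable_mx (fun o => gs_proj (X o) k) ->
    measurable_mx (fun o => gs_vec (X o) k).
  move=> mP; apply: measurable_mx_mul; first exact: measurable_mx_row.
  by apply: measurable_mx_sub => //; exact: measurable_mx_cst.
have mproj k : measurable_mx (fun o => gs_proj (X o) k).
  elim: k => [|k IH]; first exact: measurable_mx_cst.
  apply: measurable_mx_add => //; apply: measurable_mx_scale.
    by apply: (measurableT_comp (@measurable_inv R)); apply: msq; exact: mvec.
  by apply: measurable_mx_mul; [apply: measurable_mx_tr|]; exact: mvec.
move=> i j; under eq_fun do rewrite mxE.
apply: (measurable_mx_scale _ (mvec i (mproj i)) 0 j).
apply: (measurableT_comp (@measurable_inv R)).
by apply: (measurableT_comp (@measurable_sqrt R)); apply: msq; exact: mvec.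
Qed.

End gram_schmidt.

(** * Averaging over the orthogonal group *)

Lemma orthogonal_mxC (R : realType) (n : nat) (Q : 'M[R]_n) :
  orthogonal_mx Q -> Q^T *m Q = 1%:M.
Proof. exact: mulmx1C. Qed.

Lemma orthogonal_mx_tr (R : realType) (n : nat) (Q : 'M[R]_n) :
  orthogonal_mx Q -> orthogonal_mx Q^T.
Proof. by move=> oQ; rewrite /orthogonal_mx trmxK orthogonal_mxC. Qed.

(** The averaging below freezes each of the two copies in turn, so both orders of integration are
    needed. *)
Lemma product_measure_sections (R : realType) (d1 d2 : measure_display)
    (T1 : measurableType d1) (T2 : measurableType d2)
    (P1 : probability T1 R) (P2 : probability T2 R) (X : set (T1 * T2)) :
  measurable X -> (P1 \x P2)%E X = (P1 \x^ P2)%E X.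
Proof.
move=> mX; apply: (@product_measure_unique _ _ _ _ R P1 P2 (P1 \x^ P2)%E) => //.
by move=> A B mA mB; exact: product_measure2E.
Qed.

(* With [M2] an independent copy of [M], the orthogonal factor [q M2] of [M2] is
   a Haar matrix independent of [M]: its law absorbs the orthogonal matrix
   [H (M o)], fixed once [M o] is fixed, while the law of [M] absorbs [q M2]. *)
Lemma orthogonal_invariant_equivariant (R : realType) (d0 : measure_display)
    (Omega : measurableType d0) (P : probability Omega R) (n : nat)
    (M : Omega -> 'M[R]_n.+1) (H : 'M[R]_n.+1 -> 'M[R]_n.+1) :
  measurable_mx M ->
  (forall Q B, orthogonal_mx Q -> mx_borel B ->
     P (M @^-1` B) = P ((fun o => M o *m Q) @^-1` B)) ->
  P [set o | \det (M o) = 0] = 0%E ->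
  @measurable_mx R _ (mxT R n.+1 n.+1) _ _ H ->
  (forall A, orthogonal_mx (H A)) ->
  (forall A Q, orthogonal_mx Q -> H (A *m Q) = Q^T *m H A *m Q) ->
  forall B, mx_borel B ->
    P (M @^-1` B) = P ((fun o => M o *m H (M o)) @^-1` B).
Proof.
move=> mM invM detM mH oH HM B mB.
(* The transpose makes a factor on the right of [A] come out on the left of [q A], next to the
   [F (M p.1)] in [G] below. *)
pose q (A : 'M[R]_n.+1) := (gs_mx A)^T.
pose N : set 'M[R]_n.+1 := [set A | \det A != 0].
have qM (A Q : 'M[R]_n.+1) : orthogonal_mx Q -> q (A *m Q) = Q^T *m q A.
  by move=> oQ; rewrite /q gs_mx_mul// trmx_mul.
have oq A : N A -> orthogonal_mx (q A).
  by move=> dA; apply/orthogonal_mx_tr/gs_mx_orthogonal; rewrite unitmxE unitfE.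
have mN : mx_borel N.
  have mdet : measurable_fun setT (fun A : mxT R n.+1 n.+1 => \det A).
    by apply: measurable_det; exact: measurable_mx_id.
  have := mdet measurableT (~` [set 0]) (measurableC (measurable_set1 _)).
  rewrite setTI; congr (mx_borel _); apply/seteqP; split => A /=.
    by move=> /eqP.
  by move=> /eqP.
pose T (A : 'M[R]_n.+1) := A *m H A.
have TM A Q : orthogonal_mx Q -> T (A *m Q) = T A *m Q.
  by move=> oQ; rewrite /T HM// !mulmxA -(mulmxA A) oQ mulmx1.
have mT : @measurable_mx R _ (mxT R n.+1 n.+1) _ _ T.
  by apply: measurable_mx_mul => //; exact: measurable_mx_id.
have mTB : mx_borel (T @^-1` B) by exact: (measurable_mx_preimage mT mB).
pose G (F : 'M[R]_n.+1 -> 'M[R]_n.+1) : set (Omega * Omega) :=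
  [set p | N (M p.2) /\ B (F (M p.1) *m q (M p.2))].
have mG F : @measurable_mx R _ (mxT R n.+1 n.+1) _ _ F -> measurable (G F).
  move=> mF; apply: measurableI.
    have m2 : measurable_mx (fun p : Omega * Omega => M p.2).
      by move=> i j; exact: (measurableT_comp (mM i j) measurable_snd).
    exact: (measurable_mx_preimage m2 mN).
  have mq : measurable_mx (fun p : Omega * Omega => q (M p.2)).
    apply/measurable_mx_tr/measurable_gs_mx => i j.
    exact: (measurableT_comp (mM i j) measurable_snd).
  have mF1 : measurable_mx (fun p : Omega * Omega => F (M p.1)).
    move=> i j; have /measurable_mxP mM' := mM.
    exact: (measurableT_comp (measurableT_comp (mF i j) mM') measurable_fst).
  exact: (measurable_mx_preimage (measurable_mx_mul mF1 mq) mB).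
have PN : P (M @^-1` N) = 1%E.
  rewrite (_ : _ @^-1` _ = ~` [set o | \det (M o) = 0]).
    rewrite probability_setC ?detM ?sube0//.
    have := measurable_det mM measurableT (measurable_set1 0).
    by rewrite setTI.
  by apply/seteqP; split => o /= /eqP.
have GE F : @measurable_mx R _ (mxT R n.+1 n.+1) _ _ F ->
    (forall A Q, orthogonal_mx Q -> F (A *m Q) = F A *m Q) ->
    (P \x P)%E (G F) = P (M @^-1` (F @^-1` B)).
  move=> mF FM; have mFB : mx_borel (F @^-1` B) by exact: (measurable_mx_preimage mF mB).
  have mX : measurable (M @^-1` (F @^-1` B)) by exact: measurable_mx_preimage.
  have mY : measurable (M @^-1` N) by exact: measurable_mx_preimage.
  rewrite product_measure_sections; last exact: mG.
  rewrite -[RHS]mule1 -PN -(product_measure2E P P mX mY).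
  apply: eq_integral => o2 _ /=.
  have [N2|N2] := pselect (N (M o2)); last first.
    congr (P _); apply/seteqP; split => o /=; rewrite /ysection /= !inE => -[]//.
  (* With [o2] fixed, [q (M o2)] is a fixed orthogonal matrix: equivariance moves it inside [F], and
     the invariance of [M] removes it. *)
  rewrite (_ : ysection (G F) o2 = (fun o => M o *m q (M o2)) @^-1` (F @^-1` B)).
    rewrite -(invM _ _ (oq _ N2) mFB); congr (P _).
    apply/seteqP; split => o /=; rewrite /ysection /= !inE; first by split.
    by move=> [].
  apply/seteqP; split => o /=; rewrite /ysection /= !inE /G /= FM//.
  - by move=> [].
  - exact: oq.
  - exact: oq.
rewrite -(GE id)//; last exact: measurable_mx_id.
rewrite (_ : _ @^-1` B = M @^-1` (T @^-1` B))// -(GE T)//.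
apply: eq_integral => o1 _ /=.
have mS F : @measurable_mx R _ (mxT R n.+1 n.+1) _ _ F ->
    mx_borel [set A | N A /\ B (F (M o1) *m q A)].
  move=> mF; apply: (@measurableI _ (mxT R n.+1 n.+1)) => //.
  apply: (@measurable_mx_preimage _ _ (mxT R n.+1 n.+1) _ _ (fun A => F (M o1) *m q A)) => //.
  apply: measurable_mx_mul => //.
  by apply/measurable_mx_tr/measurable_gs_mx; exact: measurable_mx_id.
have oHt := orthogonal_mx_tr (oH (M o1)).
rewrite (_ : xsection (G id) o1 = M @^-1` [set A | N A /\ B (M o1 *m q A)]); last first.
  by apply/seteqP; split => o; rewrite /xsection /= inE.
(* Now [o1] is fixed. Multiplying the second copy by the transpose of [H (M o1)] turns [q A] into
   [H (M o1) *m q A], and so [M o1] into [T (M o1)]. *)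
rewrite (invM _ _ oHt); last exact: (mS id (@measurable_mx_id _ _ _)).
congr (P _); apply/seteqP; split => o; rewrite /xsection /= inE /G /=;
  rewrite /N /= qM// trmxK mulmxA det_mulmx.
- move=> [h1 h2]; split => //; apply: contra h1 => /eqP ->; by rewrite mul0r.
- move=> [h1 h2]; split => //; rewrite mulf_neq0//.
  have := congr1 determinant (oHt : _ = _); rewrite det_mulmx det1 => dH.
  by apply/eqP => d0'; move/eqP: dH; rewrite d0' mul0r eq_sym oner_eq0.
Qed.

(** * The reflection fixing the observation *)

(* The value 1 for dependent rows makes this matrix orthogonal for every [Z]. *)
Definition row_span_refl (R : realType) (k n : nat) (Z : 'M[R]_(k, n)) : 'M[R]_n :=
  if Z *m Z^T \in unitmx then 2 *: (Z^T *m invmx (Z *m Z^T) *m Z) - 1%:M else 1%:M.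

Section row_span_refl_theory.
Context (R : realType) (k n : nat).
Implicit Types (Z : 'M[R]_(k, n)).

Lemma mul_row_span_refl Z : Z *m row_span_refl Z = Z.
Proof.
rewrite /row_span_refl; case: ifP => [uZ|_]; last exact: mulmx1.
rewrite mulmxBr mulmx1 -scalemxAr !mulmxA mulmxV// mul1mx.
by rewrite scaler_nat mulr2n addrK.
Qed.

Lemma orthogonal_row_span_refl Z : orthogonal_mx (row_span_refl Z).
Proof.
rewrite /orthogonal_mx /row_span_refl; case: ifP => [uZ|_]; last by rewrite trmx1 mulmx1.
(* [E] is the orthogonal projection onto the row span, symmetric and idempotent, so [2 *: E - 1%:M]
   is a symmetric involution. *)
set S := invmx _; set E := Z^T *m S *m Z.
have tS : S^T = S by rewrite /S trmx_inv trmx_mul trmxK.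
have tE : E^T = E by rewrite /E !trmx_mul trmxK tS mulmxA.
have EE : E *m E = E.
  rewrite /E -!mulmxA (mulmxA Z) (mulmxA (Z *m _)) (mulmxA S) -/S.
  by rewrite /S mulmxV// mulmx1.
have -> : (2 *: E - 1%:M)^T = 2 *: E - 1%:M.
  by rewrite linearB linearZ /= tE trmx1.
rewrite mulmxBl !mulmxBr !mulmx1 mul1mx -scalemxAl -scalemxAr EE scalerA.
rewrite opprB addrA addrAC -scalerBl -addrA -scaleNr.
rewrite addrA -scalerDl (_ : 2 * 2 - 2 + -2 = 0) ?scale0r ?add0r//.
by ring.
Qed.

(** [Q] leaves the Gram matrix [Z *m Z^T] unchanged, hence also the branch taken and the inverse in
    it. *)
Lemma row_span_refl_mul Z (Q : 'M[R]_n) : orthogonal_mx Q ->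
  row_span_refl (Z *m Q) = Q^T *m row_span_refl Z *m Q.
Proof.
move=> oQ; have ZZ : (Z *m Q) *m (Z *m Q)^T = Z *m Z^T.
  by rewrite trmx_mul mulmxA -(mulmxA Z) oQ mulmx1.
rewrite /row_span_refl ZZ; case: ifP => _; last by rewrite mulmx1 orthogonal_mxC.
rewrite mulmxBr mulmxBl mulmx1 orthogonal_mxC//; congr (_ - _).
by rewrite -scalemxAr -scalemxAl trmx_mul !mulmxA.
Qed.

Lemma measurable_row_span_refl (d : measure_display) (T : measurableType d)
    (X : T -> 'M[R]_(k, n)) :
  measurable_mx X -> measurable_mx (fun o => row_span_refl (X o)).
Proof.
move=> mX; have mXX : measurable_mx (fun o => X o *m (X o)^T).
  by apply: measurable_mx_mul => //; exact: measurable_mx_tr.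
apply: measurable_mx_if; last exact: measurable_mx_cst.
  under eq_fun do rewrite unitmxE unitfE.
  apply: measurableT_comp => //; apply: measurable_fun_eqr => //.
  exact: measurable_det.
apply: measurable_mx_sub; last exact: measurable_mx_cst.
apply: measurable_mx_scale => //; apply: measurable_mx_mul => //.
apply: measurable_mx_mul; first exact: measurable_mx_tr.
exact: measurable_mx_inv.
Qed.

End row_span_refl_theory.

Definition obs_mx (R : realType) (k n : nat) (x : 'I_k -> R)
    (M : 'M[R]_(1 + k, n)) : 'M[R]_(k, n) :=
  (\col_i x i) *m usubmx M + dsubmx M *m (1%:M - (usubmx M)^T *m usubmx M).

Lemma obs_stack_mx (R : realType) (T : Type) (k n : nat) (x : 'I_k -> R)
    (u : T -> 'rV[R]_n) (w : 'I_k -> T -> 'rV[R]_n) (o : T) :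
  obs x (u o) (w^~ o) = obs_mx x (stack_mx u w o).
Proof.
rewrite /obs_mx /stack_mx col_mxKu col_mxKd.
apply/matrixP => i j; rewrite mxE [RHS]mxE [LHS]mxE; congr (_ + _).
  by rewrite !mxE big_ord1 !mxE.
by rewrite !mxE; apply: eq_bigr => l _; rewrite !mxE.
Qed.

Lemma obs_mx_mul (R : realType) (k n : nat) (x : 'I_k -> R)
    (M : 'M[R]_(1 + k, n)) (Q : 'M[R]_n) : orthogonal_mx Q ->
  obs_mx x (M *m Q) = obs_mx x M *m Q.
Proof.
move=> oQ; rewrite /obs_mx -mul_usub_mx -mul_dsub_mx mulmxDl.
rewrite mulmxA; congr (_ + _).
rewrite -!mulmxA; congr (_ *m _); rewrite mulmxBr mulmxBl mulmx1 mul1mx.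
by congr (_ - _); rewrite trmx_mul !mulmxA oQ mul1mx.
Qed.

Lemma measurable_obs_mx (R : realType) (d : measure_display) (T : measurableType d)
    (k n : nat) (x : 'I_k -> R) (X : T -> 'M[R]_(1 + k, n)) :
  measurable_mx X -> measurable_mx (fun o => obs_mx x (X o)).
Proof.
move=> mX; have mu : measurable_mx (fun o => usubmx (X o)).
  by move=> i j; under eq_fun do rewrite mxE; exact: mX.
apply: measurable_mx_add; first by apply: measurable_mx_mul.
apply: measurable_mx_mul; first by move=> i j; under eq_fun do rewrite mxE; exact: mX.
by apply: measurable_mx_sub => //; apply: measurable_mx_mul => //; exact: measurable_mx_tr.
Qed.

(* The i-th row of the observation is w_i plus a multiple of u. *)
Lemma obs_mx_free (R : realType) (k : nat) (x : 'I_k -> R) (M : 'M[R]_(1 + k))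
    (a : R) (c : 'rV[R]_k) : M \in unitmx ->
  a *: usubmx M + c *m obs_mx x M = 0 -> a = 0 /\ c = 0.
Proof.
move=> uM e.
(* The total coefficient of [u] once the rows of the observation are expanded; the coefficients of
   the [w_i] remain [c]. *)
pose b : 'M[R]_1 := a%:M + c *m (\col_i x i) - c *m dsubmx M *m (usubmx M)^T.
have bc : row_mx b c *m M = 0.
  rewrite -{1}[M]vsubmxK mul_row_col -[RHS]e /obs_mx /b.
  rewrite !mulmxDl mul_scalar_mx !mulmxDr mulNmx !mulmxN !mulmx1 !mulmxA -!addrA.
  by congr (_ + (_ + _)); rewrite addrC.
have /eqP : row_mx b c = 0 by rewrite -(mulmxK uM (row_mx b c)) bc mul0mx.
rewrite row_mx_eq0 => /andP[/eqP b0 /eqP c0]; split => //.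
have := b0; rewrite /b c0 !mul0mx addr0 subr0 => /matrixP /(_ 0 0).
by rewrite !mxE.
Qed.

(** A vector fixed by the reflection equals its projection, so [u] would lie in the row span of the
    observation, against [obs_mx_free]. *)
Lemma row_span_refl_obs_neq (R : realType) (k : nat) (x : 'I_k -> R)
    (M : 'M[R]_(1 + k)) : M \in unitmx ->
  usubmx M *m row_span_refl (obs_mx x M) <> usubmx M.
Proof.
move=> uM; set Z := obs_mx x M.
have uZ : Z *m Z^T \in unitmx.
  (* If [c] kills the Gram matrix, then [c *m Z] has norm zero, so independence of the rows makes
     the Gram matrix invertible. *)
  rewrite -row_free_unit -kermx_eq0; apply/rowV0P => c /sub_kermxP cZ.
  have cZ0 : c *m Z = 0.
    apply/eqP; rewrite -sqnorm_eq0 /sqnorm trmx_mul mulmxA -(mulmxA c) cZ.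
    by rewrite mul0mx mxE.
  by have [] := @obs_mx_free _ _ x M 0 c uM; rewrite ?scale0r ?add0r.
rewrite /row_span_refl uZ mulmxBr mulmx1 -scalemxAr => /eqP.
rewrite subr_eq -mulr2n => /eqP h.
have n2 : (2 : R) != 0 by rewrite pnatr_eq0.
have {h} e : usubmx M *m (Z^T *m invmx (Z *m Z^T) *m Z) = usubmx M.
  by apply: (scalerI n2); rewrite h scaler_nat.
have [] := @obs_mx_free _ _ x M (-1) (usubmx M *m (Z^T *m invmx (Z *m Z^T))) uM.
  by rewrite -[in X in _ + X]mulmxA -/Z [X in _ + X](_ : _ = usubmx M);
    rewrite ?scaleN1r ?addNr// -[RHS]e !mulmxA.
by move/eqP; rewrite oppr_eq0 oner_eq0.
Qed.

Theorem theorem5p1 (R : realType) (d : nat) (hd : (2 <= d)%N)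
  (x : 'I_d.-1 -> R) (hx : forall i, x i = 1 \/ x i = -1)
  (d0 : measure_display) (Omega : measurableType d0) (P : probability Omega R)
  (u : Omega -> 'rV[R]_d) (w : 'I_d.-1 -> Omega -> 'rV[R]_d)
  (mu : forall j, measurable_fun setT (fun o => u o 0 j))
  (mw : forall i j, measurable_fun setT (fun o => w i o 0 j))
  (hu : uniform_on_sphere P u)
  (hw : indep_std_gauss P u w)
  (uhat : 'M[R]_(d.-1, d) -> 'rV[R]_d)
  (muhat : mx_measurable uhat)
  (huhat : forall Z, on_sphere (uhat Z)) :
  (P [set o | uhat (obs x (u o) (w^~ o)) = u o] <= (1 / 2)%:E)%E.
Proof.
(* Here [d = n.+2], so that [u] and the [n.+1] noise rows form a square matrix. *)
case: d hd x hx u w mu mw hu hw uhat muhat huhat => [//|[//|n]] _ x _ u w mu mw hu hw uhat muhat _.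
pose M (o : Omega) : 'M[R]_n.+2 := stack_mx u w o.
pose Z (A : 'M[R]_n.+2) : 'M[R]_(n.+1, n.+2) := obs_mx x (A : 'M[R]_(1 + n.+1, n.+2)).
pose first (A : 'M[R]_n.+2) : 'rV[R]_n.+2 := @usubmx R 1 n.+1 n.+2 A.
pose H A := row_span_refl (Z A).
pose B : set 'M[R]_n.+2 := [set A | uhat (Z A) = first A].
have mM : measurable_mx M := measurable_stack_mx mu mw.
have mid := @measurable_mx_id R n.+2 n.+2.
have mZ : @measurable_mx R _ (mxT R n.+2 n.+2) _ _ Z by exact: measurable_obs_mx.
have mB : mx_borel B.
  apply: (@measurable_mx_eq R _ (mxT R n.+2 n.+2)); last first.
    by move=> i j; under eq_fun do rewrite mxE; exact: mid.
  have muh : measurable_fun setT (uhat : mxT R n.+1 n.+2 -> mxT R 1 n.+2).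
    by move=> _ C mC; rewrite setTI; exact: muhat.
  have /measurable_mxP mZ' := mZ.
  by apply/measurable_mxP; exact: (measurableT_comp muh mZ').
have mH : @measurable_mx R _ (mxT R n.+2 n.+2) _ _ H by exact: measurable_row_span_refl.
have oH A : orthogonal_mx (H A) by exact: orthogonal_row_span_refl.
have HM A Q : orthogonal_mx Q -> H (A *m Q) = Q^T *m H A *m Q.
  by move=> oQ; rewrite /H /Z obs_mx_mul// row_span_refl_mul.
have det0 := det_stack_mx_neq0 mu mw hu hw.
have PB := orthogonal_invariant_equivariant mM
  (fun Q B oQ => stack_mx_law_orthogonal mu mw hw hu oQ) det0 mH oH HM mB.
pose E := M @^-1` B; pose E' := (fun o => M o *m H (M o)) @^-1` B.
have -> : [set o | uhat (obs x (u o) (w^~ o)) = u o] = E.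
  apply/seteqP; split => o; rewrite /E /B /= /Z /first obs_stack_mx /M {2}/stack_mx col_mxKu//.
have mE : measurable E by exact: measurable_mx_preimage.
have mE' : measurable E'.
  apply: measurable_mx_preimage mB; apply: measurable_mx_mul => // i j.
  by have /measurable_mxP mM' := mM; exact: (measurableT_comp (mH i j) mM').
(* On both events one value of [uhat] equals [u] and its mirror image, which coincide only where
   [M o] is singular. *)
have EE0 : P (E `&` E') = 0%E.
  apply/negligibleP; first exact: measurableI.
  apply: (negligibleS (A := [set o | \det (M o) = 0])).
    move=> o [/= e e']; apply: contrapT => /eqP dM.
    have uM : M o \in unitmx by rewrite unitmxE unitfE.
    apply: (@row_span_refl_obs_neq R n.+1 x (M o) uM).
    rewrite -/(Z (M o)) -/(H (M o)) mul_usub_mx -/(first _) -/(first _) -e -e'.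
    by congr uhat; rewrite /Z obs_mx_mul// /H mul_row_span_refl.
  apply/negligibleP => //.
  have := measurable_det mM measurableT (measurable_set1 0).
  by rewrite setTI.
(* As [E] and [E'] are equally likely and overlap in a null set, twice the probability of [E] is at
   most 1. *)
have : (P (E `|` E') <= 1)%E by apply: probability_le1; exact: measurableU.
have PU : P (E `|` E') = (P E + P E' - P (E `&` E'))%E.
  by apply: measureUfinl => //; rewrite ltey_eq fin_num_measure.
have PE' : P E' = P E by exact/esym/PB.
rewrite PU EE0 sube0 PE' -(fineK (fin_num_measure P _ mE)).
by rewrite -EFinD !lee_fin; lra.
Qed.
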